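(* Let $D=\{z\in\mathbb C: |z|<R\}$ with $0<R<\infty$, and let $d\mu(z)=m(z)\,d\lambda(z)$, where $m\ge 0$ is a radially symmetric weight ($m(z)$ depends only on $|z|$) such that the monomials $\{z^n\}_{n\in\mathbb N_0}$ belong to $A^2(D,d\mu)$ and form an orthogonal basis of $A^2(D,d\mu)$. Put $c_n^2=\int_D |z|^{2n}\,d\mu(z)$. Then the canonical solution operator $S: A^2(D,d\mu)\to L^2(D,d\mu)$ to $\overline\partial$ is a Hilbert–Schmidt operator if and only if $\lim_{n\to\infty} \frac{c_{n+1}^2}{c_n^2}<\infty$ (i.e. the sequence $c_{n+1}^2/c_n^2$ converges to a finite limit).
   Context: $d\lambda$ denotes Lebesgue measure. $A^2(D,d\mu)$ is the (weighted Bergman) space of holomorphic functions $g$ on $D$ with $\int_D|g|^2\,d\mu<\infty$, a closed subspace of $L^2(D,d\mu)$. The canonical solution operator $S$ assigns to $g\in A^2(D,d\mu)$ the unique function $u=S(g)\in L^2(D,d\mu)$ with $\overline\partial u=g$ (in the distributional sense) and $u\perp A^2(D,d\mu)$ in $L^2(D,d\mu)$; equivalently $S(g)=\overline z g-P(\overline z g)$ where $P$ is the orthogonal (Bergman) projection of $L^2(D,d\mu)$ onto $A^2(D,d\mu)$. *)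

(* Defs.v *)
(* C is modelled by [R[i]] (mathcomp-real-closed
   complex numbers over R : realType); planar Lebesgue measure is the product
   measure [lebesgue_measure \x lebesgue_measure] on [R * R], transported to C
   via [toC (x, y) = x + i y]. *)
From mathcomp Require Import all_boot all_algebra all_classical all_reals all_analysis.
From mathcomp Require Export complex.
Export GRing.Theory Num.Theory numFieldNormedType.Exports.

Set Implicit Arguments.
Unset Strict Implicit.
Unset Printing Implicit Defensive.

Local Open Scope ring_scope.
Local Open Scope classical_set_scope.

Section Bergman.
Variable R : realType.

(* identification R^2 = C *)
Definition toC (p : R * R) : R[i] := (p.1 +i* p.2)%C.

(* |w|^2 as a real number *)
Definition cabs2 (w : R[i]) : R := complex.Re w ^+ 2 + complex.Im w ^+ 2.

(* planar Lebesgue measure *)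
Definition leb2 := ((@lebesgue_measure R) \x (@lebesgue_measure R))%E.

(* the disc D = {z : |z| < Rad}, in C and in R^2 *)
Definition discC (Rad : R) : set R[i] := [set z | cabs2 z < Rad ^+ 2].
Definition disc2 (Rad : R) : set (R * R) := [set p | cabs2 (toC p) < Rad ^+ 2].

(* radial weight m(z) = w(|z|), as a function on R^2 *)
Definition weight (w : R -> R) (p : R * R) : R := w (Num.sqrt (cabs2 (toC p))).

(* \int_D |f|^2 dmu, where dmu = m dlambda *)
Definition nrm2 (Rad : R) (w : R -> R) (f : R[i] -> R[i]) : \bar R :=
  (\int[leb2]_(p in disc2 Rad) (cabs2 (f (toC p)) * weight w p)%:E)%E.

(* f belongs to L^2(D, dmu) *)
Definition L2 (Rad : R) (w : R -> R) (f : R[i] -> R[i]) : Prop :=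
  measurable_fun (disc2 Rad) (fun p => complex.Re (f (toC p))) /\
  measurable_fun (disc2 Rad) (fun p => complex.Im (f (toC p))) /\
  (nrm2 Rad w f < +oo)%E.

(* inner product <f, g> = \int_D f conj(g) dmu (real and imaginary parts) *)
Definition cinner (Rad : R) (w : R -> R) (f g : R[i] -> R[i]) : R[i] :=
  (Rintegral leb2 (disc2 Rad)
    (fun p => complex.Re (f (toC p) * (g (toC p))^*) * weight w p)
  +i*
  Rintegral leb2 (disc2 Rad)
    (fun p => complex.Im (f (toC p) * (g (toC p))^*) * weight w p))%C.

(* holomorphic on D: complex differentiable at every point of D *)
Definition holomorphic_on (A : set R[i]) (g : R[i] -> R[i]) : Prop :=
  forall z, A z -> derivable (g : (R[i])^o -> (R[i])^o) z 1.

(* g belongs to the weighted Bergman space A^2(D, dmu) *)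
Definition bergman (Rad : R) (w : R -> R) (g : R[i] -> R[i]) : Prop :=
  holomorphic_on (discC Rad) g /\ L2 Rad w g.

(* the monomial z^n *)
Definition monomial (n : nat) : R[i] -> R[i] := fun z => z ^+ n.

(* {e_n} is an orthogonal basis of A^2(D, dmu) (nonzero, pairwise orthogonal,
   complete) *)
Definition orthogonal_basis (Rad : R) (w : R -> R) (e : nat -> R[i] -> R[i]) :=
  (forall n, bergman Rad w (e n)) /\
  (forall n, nrm2 Rad w (e n) != 0%E) /\
  (forall i j, i != j -> cinner Rad w (e i) (e j) = 0) /\
  (forall f, bergman Rad w f -> (forall n, cinner Rad w f (e n) = 0) ->
     nrm2 Rad w f = 0%E).

(* {e_n} is an orthonormal basis of A^2(D, dmu) *)
Definition orthonormal_basis (Rad : R) (w : R -> R) (e : nat -> R[i] -> R[i]) :=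
  (forall n, bergman Rad w (e n)) /\
  (forall i j, cinner Rad w (e i) (e j) = (i == j)%:R) /\
  (forall f, bergman Rad w f -> (forall n, cinner Rad w f (e n) = 0) ->
     nrm2 Rad w f = 0%E).

(* u = S(g) for the canonical solution operator S of dbar:
   u = conj(z) g - P(conj(z) g), i.e. u = conj(z) g - h on D with h in A^2
   and u orthogonal to A^2. *)
Definition canonical_solution (Rad : R) (w : R -> R) (g u : R[i] -> R[i]) :=
  L2 Rad w u /\
  (exists h, bergman Rad w h /\
     forall z, discC Rad z -> u z = z^* * g z - h z) /\
  (forall f, bergman Rad w f -> cinner Rad w u f = 0).

(* S is Hilbert-Schmidt: sum_n ||S e_n||^2 < oo for an orthonormal basis *)
Definition S_hilbert_schmidt (Rad : R) (w : R -> R) :=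
  exists e : nat -> R[i] -> R[i], orthonormal_basis Rad w e /\
  exists u : nat -> R[i] -> R[i],
    (forall n, canonical_solution Rad w (e n) (u n)) /\
    (\sum_(n <oo) nrm2 Rad w (u n) < +oo)%E.

(* c_n^2 = \int_D |z|^{2n} dmu *)
Definition cn2 (Rad : R) (w : R -> R) (n : nat) : R :=
  fine (nrm2 Rad w (monomial n)).

End Bergman.

(* Main.v *)
(* Both sides hold outright. Put a n = c_{n+1}^2 / c_n^2. Since
   conj(z) z^n is orthogonal to every monomial except z^(n-1), the canonical
   solution for e_n = z^n / c_n is u_n = conj(z) e_n - (c_n / c_{n-1}^2) z^(n-1),
   and |u_n|^2 integrates to a n - a (n-1). Hence a is nondecreasing; it is
   bounded by Rad^2, so it converges, and the sum of the |u_n|^2 telescopes.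

   The point is that u_n is orthogonal to all of A^2. A^2 need not be closed in
   L^2 (the weight may vanish near the boundary), so completeness of the
   monomials does not suffice. Instead, orthogonality of the monomials gives
   int z^i conj(z)^j P(|z|^2) dmu = 0 for i <> j and every polynomial P, hence,
   by letting P converge to an indicator function, orthogonality of the monomials
   on smaller concentric discs. There a holomorphic f is a uniform limit of
   polynomials, and the radius then tends to Rad by dominated convergence.

   The polynomial approximation is Cauchy's theorem: Goursat's bisection for
   rectangles, pulled back along exp, shows that means over circles of a function
   holomorphic in an annulus do not depend on the radius. *)
Require Import Defs.
From mathcomp Require Import all_boot all_order all_algebra all_classical all_reals all_analysis.
From mathcomp Require Import measurable_realfun complex ring lra.
Import Order.TTheory GRing.Theory Num.Theory numFieldNormedType.Exports.
Set Implicit Arguments.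
Unset Strict Implicit.
Unset Printing Implicit Defensive.
Local Open Scope ring_scope.
Local Open Scope classical_set_scope.

(** Passing to a smaller disc changes the inner products: there u_n is in general no longer
    orthogonal to z^(n-1), since its coefficient comes from moments of the full disc. The
    coefficients are therefore recomputed from the moments of each smaller disc, which makes the
    vanishing exact, and they tend to the original ones as the radius grows. Denominators are
    cleared beforehand, because a moment of a small disc is 0 when the weight vanishes there. The
    limit is dominated because z^0 in A^2 gives dmu finite mass: |f| <= 1 + |f|^2 is then
    integrable, also against bounded factors. Polynomials in |z|^2 take the place of polar
    coordinates: a factor |z|^(2l) raises both exponents of z^i conj(z)^j alike and so keeps them
    distinct. In Cauchy's theorem, exp only compares circles inside an annulus. Its range misses the
    centre, and the difference quotient of f at a is at first only continuous at a; both radii are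
    crossed by continuity of the circle integral in the radius. *)

(** * Real and imaginary parts, conjugation and the real-valued modulus *)

Section ComplexArithmetic.
Variable R : realType.
Implicit Types (x y z : R[i]) (a b : R).

Lemma complexP x y :
  complex.Re x = complex.Re y -> complex.Im x = complex.Im y -> x = y.
Proof. by case: x y => a b [c d] /= -> ->. Qed.

Lemma ReD x y : complex.Re (x + y) = complex.Re x + complex.Re y.
Proof. by case: x y => a b [c d]. Qed.

Lemma ImD x y : complex.Im (x + y) = complex.Im x + complex.Im y.
Proof. by case: x y => a b [c d]. Qed.

Lemma ReN x : complex.Re (- x) = - complex.Re x.
Proof. by case: x. Qed.

Lemma ImN x : complex.Im (- x) = - complex.Im x.
Proof. by case: x. Qed.

Lemma ReM x y : complex.Re (x * y) =
  complex.Re x * complex.Re y - complex.Im x * complex.Im y.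
Proof. by case: x y => a b [c d]. Qed.

Lemma ImM x y : complex.Im (x * y) =
  complex.Re x * complex.Im y + complex.Im x * complex.Re y.
Proof. by case: x y => a b [c d]. Qed.

Lemma ReC a : complex.Re (a%:C)%C = a. Proof. by []. Qed.
Lemma ImC a : complex.Im (a%:C)%C = 0. Proof. by []. Qed.
Lemma ReJ x : complex.Re (x^*)%C = complex.Re x. Proof. by case: x. Qed.
Lemma ImJ x : complex.Im (x^*)%C = - complex.Im x. Proof. by case: x. Qed.
Lemma Re_i : complex.Re 'i%C = 0 :> R. Proof. by []. Qed.
Lemma Im_i : complex.Im 'i%C = 1 :> R. Proof. by []. Qed.
Lemma Re0 : complex.Re (0 : R[i]) = 0. Proof. by []. Qed.
Lemma Im0 : complex.Im (0 : R[i]) = 0. Proof. by []. Qed.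
Lemma Re1 : complex.Re (1 : R[i]) = 1. Proof. by []. Qed.
Lemma Im1 : complex.Im (1 : R[i]) = 0. Proof. by []. Qed.
Lemma Re_mk a b : complex.Re (Complex a b) = a. Proof. by []. Qed.
Lemma Im_mk a b : complex.Im (Complex a b) = b. Proof. by []. Qed.

Lemma ComplexB (a b a' b' : R) :
  Complex a b - Complex a' b' = Complex (a - a') (b - b').
Proof. by []. Qed.

Lemma Complex_im a : Complex 0 a = 'i%C * a%:C%C.
Proof. by rewrite [LHS]complexE rmorph0 add0r. Qed.

Definition reimE :=
  (ReD, ImD, ReN, ImN, ReM, ImM, ReC, ImC, ReJ, ImJ, Re_i, Im_i, Re0, Im0, Re1, Im1,
   Re_mk, Im_mk).

Lemma conjcM x y : conjc (x * y) = conjc x * conjc y.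
Proof. exact: rmorphM. Qed.

Lemma conjcB x y : conjc (x - y) = conjc x - conjc y.
Proof. exact: rmorphB. Qed.

Lemma conjcX x n : conjc (x ^+ n) = conjc x ^+ n.
Proof. exact: rmorphXn. Qed.

Lemma real_complexM a b : (a * b)%:C%C = a%:C%C * b%:C%C.
Proof. exact: rmorphM. Qed.

Lemma real_complexB a b : (a - b)%:C%C = a%:C%C - b%:C%C.
Proof. exact: rmorphB. Qed.

Lemma real_complexV a : (a^-1)%:C%C = a%:C%C^-1.
Proof. exact: fmorphV. Qed.

Definition cabs x : R := Normc.normc x.

Lemma cabsE x : cabs x = Num.sqrt (cabs2 x).
Proof. by case: x. Qed.

Lemma cabs2_ge0 x : 0 <= cabs2 x.
Proof. by rewrite addr_ge0 ?sqr_ge0. Qed.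

Lemma sqr_cabs x : cabs x ^+ 2 = cabs2 x.
Proof. by rewrite cabsE sqr_sqrtr ?cabs2_ge0. Qed.

Lemma cabs_ge0 x : 0 <= cabs x.
Proof. by rewrite cabsE sqrtr_ge0. Qed.

Lemma normC_cabs x : `|x| = (cabs x)%:C%C.
Proof. by rewrite normc_def cabsE. Qed.

Lemma cabsM x y : cabs (x * y) = cabs x * cabs y.
Proof. exact: Normc.normcM. Qed.

Lemma cabsV x : cabs x^-1 = (cabs x)^-1.
Proof. exact: Normc.normcV. Qed.

Lemma cabsN x : cabs (- x) = cabs x.
Proof. exact: normcN. Qed.

Lemma cabs_distC x y : cabs (x - y) = cabs (y - x).
Proof. by rewrite -opprB cabsN. Qed.

Lemma cabsJ x : cabs (x^*)%C = cabs x.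
Proof. by rewrite !cabsE /cabs2 !reimE sqrrN. Qed.

Lemma cabsC a : cabs (a%:C)%C = `|a|.
Proof. by rewrite cabsE /cabs2 !reimE expr0n /= addr0 sqrtr_sqr. Qed.

Lemma cabs0 : cabs 0 = 0. Proof. exact: Normc.normc0. Qed.
Lemma cabs1 : cabs 1 = 1. Proof. exact: Normc.normc1. Qed.

Lemma cabsX x n : cabs (x ^+ n) = cabs x ^+ n.
Proof.
by elim: n => [|n IHn]; rewrite ?expr0 ?cabs1// !exprS cabsM IHn.
Qed.

Lemma cabs_i : cabs 'i%C = 1.
Proof. by rewrite cabsE /cabs2 !reimE expr0n add0r expr1n sqrtr1. Qed.

Lemma cabs_eq0 x : (cabs x == 0) = (x == 0).
Proof.
by apply/eqP/eqP => [/Normc.eq0_normc //|->]; exact: cabs0.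
Qed.

Lemma cabs_gt0 x : (0 < cabs x) = (x != 0).
Proof. by rewrite lt_neqAle cabs_ge0 andbT eq_sym cabs_eq0. Qed.

Lemma le_cabsD x y : cabs (x + y) <= cabs x + cabs y.
Proof. exact: le_normcD. Qed.

Lemma le_cabsB x y : cabs (x - y) <= cabs x + cabs y.
Proof. by rewrite (le_trans (le_cabsD _ _))// cabsN. Qed.

Lemma cabs_sub_le x y : cabs x - cabs y <= cabs (x - y).
Proof. by rewrite lerBlDr -{1}(subrK y x) le_cabsD. Qed.

Lemma norm_Re_le x : `|complex.Re x| <= cabs x.
Proof. by rewrite cabsE -sqrtr_sqr ler_sqrt ?cabs2_ge0// lerDl sqr_ge0. Qed.

Lemma norm_Im_le x : `|complex.Im x| <= cabs x.
Proof. by rewrite cabsE -sqrtr_sqr ler_sqrt ?cabs2_ge0// lerDr sqr_ge0. Qed.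

Lemma cabs_le_ReIm x : cabs x <= `|complex.Re x| + `|complex.Im x|.
Proof.
by rewrite {1}(complexE x) (le_trans (le_cabsD _ _))// cabsM cabs_i !cabsC mul1r.
Qed.

Lemma cabs2M x y : cabs2 (x * y) = cabs2 x * cabs2 y.
Proof. by rewrite -!sqr_cabs cabsM exprMn. Qed.

Lemma cabs2X x n : cabs2 (x ^+ n) = cabs2 x ^+ n.
Proof. by rewrite -!sqr_cabs cabsX exprAC. Qed.

Lemma mulcJ x : x * (x^*)%C = (cabs2 x)%:C%C.
Proof. by apply: complexP; rewrite !reimE /cabs2; ring. Qed.

Lemma lt_cabs2 x a : 0 <= a -> (cabs2 x < a ^+ 2) = (cabs x < a).
Proof. by move=> a0; rewrite -sqr_cabs ltr_pXn2r// nnegrE cabs_ge0. Qed.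

End ComplexArithmetic.

(** * Complex derivatives with real error bounds *)

Section ComplexDifferentiability.
Variable R : realType.
Implicit Types (f g : R[i] -> R[i]) (z : R[i]).

(** The norm of [R[i]] is itself [R[i]]-valued; here [e], [d] and all moduli live in [R]. Without a
    quotient, the point [v = z] needs no exclusion. *)
Definition has_cderiv f z c := forall e : R, 0 < e -> exists2 d : R, 0 < d &
  forall v, cabs (v - z) < d -> cabs (f v - f z - c * (v - z)) <= e * cabs (v - z).

Definition ccontinuous_at f z := forall e : R, 0 < e -> exists2 d : R, 0 < d &
  forall v, cabs (v - z) < d -> cabs (f v - f z) <= e.

(** Stated over any [numFieldType] for two uses: [K = R[i]] gives complex derivatives, [K = R] the
    expansions of [expR], [cos] and [sin] at 0. *)
Lemma derivable_linear_approx (K : numFieldType) (f : K^o -> K^o) (a : K^o) :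
  derivable f a 1 -> forall e : K, 0 < e -> exists2 d : K, 0 < d &
  forall v : K, `|v - a| < d ->
    `|f v - f a - 'D_1 f a * (v - a)| <= e * `|v - a|.
Proof.
move=> /cvgrPdist_le h e e0.
have [d /= d0 hd] := h e e0; exists d => // v vd.
have [->|nva] := eqVneq v a; first by rewrite !subrr mulr0 subrr !normr0 mulr0.
have va0 : v - a != 0 by rewrite subr_eq0.
have := hd (v - a); rewrite /ball_/= sub0r normrN => /(_ vd va0).
rewrite -/('D_1 f a) /GRing.scale /= mulr1 subrK distrC => {}hd.
rewrite -(ler_pM2l (x := `|(v - a)^-1|)) ?normr_gt0 ?invr_eq0//.
rewrite -normrM mulrBr (mulrC ('D_1 f a)) mulKf//.
by rewrite mulrCA -normrM mulVf// normr1 mulr1.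
Qed.

Lemma derivable_has_cderiv f z :
  derivable (f : R[i]^o -> R[i]^o) z 1 ->
  has_cderiv f z ('D_1 (f : R[i]^o -> R[i]^o) z).
Proof.
move=> df e e0.
have ec0 : 0 < e%:C%C :> R[i] by rewrite ltcR.
have [d d0 hd] := derivable_linear_approx df ec0.
(* Positivity in [R[i]] forces [d] to be real, so its real part is the same radius. *)
move: d0; rewrite ltcE => /andP[/eqP d1 d2].
exists (complex.Re d) => // v vz.
have := hd v; rewrite !normC_cabs -rmorphM/= lecR; apply.
by rewrite ltcE !reimE/= d1 eqxx.
Qed.

Lemma has_cderiv_continuous f z c : has_cderiv f z c -> ccontinuous_at f z.
Proof.
move=> hf e e0; have [d d0 hd] := hf 1 ltr01.
have k0 : 0 < 1 + cabs c by rewrite ltr_wpDr ?cabs_ge0.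
exists (Num.min d (e / (1 + cabs c))) => [|v].
  by rewrite lt_min d0 divr_gt0.
rewrite lt_min => /andP[/hd h1]; rewrite ltr_pdivlMr// => h2.
rewrite -(subrK (c * (v - z)) (f v - f z)) (le_trans (le_cabsD _ _))//.
rewrite (le_trans _ (ltW h2))// cabsM.
by rewrite [leRHS]mulrDr mulr1 (mulrC (cabs c)) lerD2r (le_trans h1)// mul1r.
Qed.

Lemma has_cderiv_comp f g z b c :
  has_cderiv f (g z) c -> has_cderiv g z b ->
  has_cderiv (f \o g) z (c * b).
Proof.
move=> hf hg e e0.
(* The summand 1 keeps the divisors positive when [b] or [c] is 0. *)
have k0 : 0 < 1 + cabs b by rewrite ltr_wpDr ?cabs_ge0.
have m0 : 0 < 1 + cabs c by rewrite ltr_wpDr ?cabs_ge0.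
have [d1 d10 h1] := hf (e / 2 / (1 + cabs b)) ltac:(by rewrite !divr_gt0).
have [d2 d20 h2] := hg 1 ltr01.
have [d3 d30 h3] := hg (e / 2 / (1 + cabs c)) ltac:(by rewrite !divr_gt0).
exists (Num.min (d1 / (1 + cabs b)) (Num.min d2 d3)) => [|v].
  by rewrite !lt_min d20 d30 divr_gt0.
rewrite !lt_min => /and3P[vd1 /h2 {}h2 /h3 {}h3].
have gv : cabs (g v - g z) <= (1 + cabs b) * cabs (v - z).
  rewrite -(subrK (b * (v - z)) (g v - g z)) (le_trans (le_cabsD _ _))//.
  by rewrite mulrDl cabsM lerD2r.
rewrite /= (_ : f (g v) - f (g z) - c * b * (v - z) =
  (f (g v) - f (g z) - c * (g v - g z)) + c * (g v - g z - b * (v - z)));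
  last by ring.
rewrite (le_trans (le_cabsD _ _))// (splitr e) mulrDl lerD//.
  apply: (le_trans (h1 _ _)).
    by apply: (le_lt_trans gv); rewrite mulrC -ltr_pdivlMr.
  rewrite mulrAC ler_pdivrMr// -[leRHS]mulrA [X in _ <= _ * X]mulrC.
  by rewrite ler_wpM2l// divr_ge0// ltW.
rewrite cabsM; apply: (@le_trans _ _ ((1 + cabs c) * cabs (g v - g z - b * (v - z)))).
  by rewrite ler_wpM2r ?cabs_ge0// lerDr.
rewrite (le_trans (ler_wpM2l (ltW m0) h3))// mulrA mulrCA divff ?mulr1//.
by rewrite gt_eqF.
Qed.

End ComplexDifferentiability.

(** * The complex exponential and its derivative *)

Section ComplexExponential.
Variable R : realType.
Implicit Types (z w : R[i]).

Definition cexp z : R[i] :=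
  Complex (expR (complex.Re z) * cos (complex.Im z))
          (expR (complex.Re z) * sin (complex.Im z)).

Lemma cexpD z w : cexp (z + w) = cexp z * cexp w.
Proof.
by apply: complexP; rewrite [RHS]reimE /= !reimE expRD ?cosD ?sinD; ring.
Qed.

Lemma cabs_cexp z : cabs (cexp z) = expR (complex.Re z).
Proof.
rewrite cabsE /cabs2 /= !exprMn -mulrDr cos2Dsin2 mulr1 sqrtr_sqr.
by rewrite ger0_norm// expR_ge0.
Qed.

Lemma cexp_approx0 (e : R) : 0 < e -> exists2 d : R, 0 < d &
  forall v, cabs v < d -> cabs (cexp v - 1 - v) <= e * cabs v.
Proof.
(* With [E = expR 1], which bounds exp(Re v) for |v| < 1, the real and imaginary remainders add up
   to at most (3 + 2 E) k |v|, and 3 + 2 E <= 8 E. *)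
move=> e0; set k := e / (8 * expR 1).
have k0 : 0 < k by rewrite divr_gt0 ?mulr_gt0 ?expR_gt0.
have lin (f : R -> R) (c : R) : is_derive (0:R) (1:R) f c ->
    exists2 d : R, 0 < d & forall v, `|v| < d ->
      `|f v - f 0 - c * v| <= k * `|v|.
  move=> hf; have [d d0 hd] := derivable_linear_approx (@ex_derive _ _ _ _ _ _ _ hf) k0.
  by exists d => // v; have := hd v; rewrite subr0 derive_val.
have [d1 d10 h1] := lin _ _ (is_derive_expR 0).
have [d2 d20 h2] := lin _ _ (is_derive_cos 0).
have [d3 d30 h3] := lin _ _ (is_derive_sin 0).
have E1 : 1 <= expR 1 :> R by rewrite -[leLHS](expR0 R) ler_expR.
exists (Num.min (Num.min 1 k) (Num.min d1 (Num.min d2 d3))).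
  by rewrite !lt_min ltr01 k0 d10 d20 d30.
move=> v; rewrite !lt_min => /and3P[/andP[v1 vk] vd1 /andP[vd2 vd3]].
have := h1 _ (le_lt_trans (norm_Re_le v) vd1).
have := h2 _ (le_lt_trans (norm_Im_le v) vd2).
have := h3 _ (le_lt_trans (norm_Im_le v) vd3).
rewrite expR0 cos0 sin0 oppr0 mul0r !mul1r !subr0 addr0 => {}h3 {}h2 {}h1.
have x1 := norm_Re_le v; have y1 := norm_Im_le v.
set x := complex.Re v in h1 x1 *; set y := complex.Im v in h2 h3 y1 *.
set a := cabs v in v1 vk x1 y1 *; set E := expR 1 in E1 *.
have a0 : 0 <= a by exact: cabs_ge0.
have EE : expR x <= E by rewrite ler_expR (le_trans (ler_norm _))// (le_trans x1)// ltW.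
have ke : k * (8 * E) = e by rewrite /k divfK// gt_eqF// mulr_gt0// expR_gt0.
have Ex1 : `|expR x - 1| <= 2 * k.
  rewrite -(subrK x (expR x - 1)) (le_trans (ler_normD _ _))//.
  rewrite (_ : 2 * k = k * 1 + k); last by ring.
  rewrite lerD//; last by rewrite (le_trans x1)// ltW.
  by rewrite (le_trans h1)// ler_wpM2l ?(ltW k0)// (le_trans x1)// ltW.
have kxa : k * `|x| <= k * a by rewrite ler_wpM2l// ltW.
have kya : k * `|y| <= k * a by rewrite ler_wpM2l// ltW.
have re : `|complex.Re (cexp v - 1 - v)| <= k * a + E * (k * a).
  rewrite !reimE /= -/x -/y (_ : expR x * cos y - 1 - x =
    (expR x - 1 - x) + expR x * (cos y - 1)); last by ring.
  rewrite (le_trans (ler_normD _ _))// lerD//; first exact: le_trans h1 _.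
  rewrite normrM (ger0_norm (expR_ge0 x)).
  by rewrite ler_pM ?expR_ge0//; exact: le_trans h2 _.
have im : `|complex.Im (cexp v - 1 - v)| <= E * (k * a) + 2 * k * a.
  rewrite !reimE /= -/x -/y (_ : expR x * sin y - 0 - y =
    expR x * (sin y - y) + (expR x - 1) * y); last by ring.
  rewrite (le_trans (ler_normD _ _))// !normrM (ger0_norm (expR_ge0 x)).
  by apply: lerD; apply: ler_pM; rewrite ?expR_ge0//; exact: le_trans h3 _.
rewrite (le_trans (cabs_le_ReIm _))// (le_trans (lerD re im))// -ke.
have ka : 0 <= k * a by rewrite mulr_ge0// ltW.
have : 0 <= (E - 1) * (k * a) by apply: mulr_ge0 => //; rewrite subr_ge0.
have : 0 <= E * (k * a) by apply: mulr_ge0 => //; exact: expR_ge0.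
lra.
Qed.

(** The functional equation moves the expansion at 0 to [z]: the remainder at [z] is [cexp z] times
    the remainder at 0. *)
Lemma cexp_has_cderiv z : has_cderiv cexp z (cexp z).
Proof.
move=> e e0.
have [d d0 hd] := cexp_approx0 (divr_gt0 e0 (expR_gt0 (complex.Re z))).
exists d => // v /hd {}hd.
rewrite -{1}(subrK z v) (addrC (v - z)) cexpD.
rewrite (_ : _ - _ - _ = cexp z * (cexp (v - z) - 1 - (v - z))); last by ring.
rewrite cabsM cabs_cexp (le_trans (ler_wpM2l (expR_ge0 _) hd))//.
by rewrite mulrA mulrCA divff ?mulr1// gt_eqF// expR_gt0.
Qed.

End ComplexExponential.

(** * Integration of complex-valued functions *)

Section ComplexIntegral.
Context d (T : measurableType d) (R : realType).
Variable mu : {measure set T -> \bar R}.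
Implicit Types (D : set T) (F G : T -> R[i]).

Definition cintegrable D F :=
  mu.-integrable D (EFin \o (fun x => complex.Re (F x))) /\
  mu.-integrable D (EFin \o (fun x => complex.Im (F x))).

Definition cintegral D F : R[i] :=
  Complex (Rintegral mu D (fun x => complex.Re (F x)))
          (Rintegral mu D (fun x => complex.Im (F x))).

Lemma eq_cintegral D F G : {in D, F =1 G} -> cintegral D F = cintegral D G.
Proof.
by move=> FG; congr Complex; apply: eq_Rintegral => x xD; rewrite FG.
Qed.

Lemma eq_cintegrable D F G : measurable D -> {in D, F =1 G} ->
  cintegrable D F -> cintegrable D G.
Proof.
move=> mD FG [iR iI]; split.
  by apply: eq_integrable iR => // x xD /=; rewrite FG.
by apply: eq_integrable iI => // x xD /=; rewrite FG.
Qed.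

Lemma cintegrableD D F G : measurable D -> cintegrable D F -> cintegrable D G ->
  cintegrable D (fun x => F x + G x).
Proof.
move=> mD [FR FI] [GR GI]; split.
- apply: eq_integrable (integrableD mD FR GR) => // x _ /=.
  by rewrite -EFinD -ReD.
- apply: eq_integrable (integrableD mD FI GI) => // x _ /=.
  by rewrite -EFinD -ImD.
Qed.

Lemma cintegralD D F G : measurable D -> cintegrable D F -> cintegrable D G ->
  cintegral D (fun x => F x + G x) = cintegral D F + cintegral D G.
Proof.
move=> mD [FR FI] [GR GI]; apply: complexP; rewrite /= -RintegralD//.
  by apply: eq_Rintegral => x _; rewrite ReD.
by apply: eq_Rintegral => x _; rewrite ImD.
Qed.

Let Rintegrable_lin D (a b : R) (f g : T -> R) : measurable D ->
  mu.-integrable D (EFin \o f) -> mu.-integrable D (EFin \o g) ->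
  mu.-integrable D (EFin \o (fun x => a * f x + b * g x)).
Proof.
move=> mD iF iG.
apply: eq_integrable (integrableD mD (integrableZl mD a iF) (integrableZl mD b iG)) => //.
Qed.

Let Rintegral_lin D (a b : R) (f g : T -> R) : measurable D ->
  mu.-integrable D (EFin \o f) -> mu.-integrable D (EFin \o g) ->
  Rintegral mu D (fun x => a * f x + b * g x) =
  a * Rintegral mu D f + b * Rintegral mu D g.
Proof.
move=> mD iF iG; rewrite RintegralD//.
- by rewrite !RintegralZl.
- exact: eq_integrable (integrableZl mD a iF).
- exact: eq_integrable (integrableZl mD b iG).
Qed.

Lemma cintegrableZ D (k : R[i]) F : measurable D -> cintegrable D F ->
  cintegrable D (fun x => k * F x).
Proof.
move=> mD [FR FI]; split.
- apply: eq_integrable (Rintegrable_lin (complex.Re k) (- complex.Im k) mD FR FI) => //.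
  by move=> x _ /=; rewrite ReM mulNr.
- apply: eq_integrable (Rintegrable_lin (complex.Re k) (complex.Im k) mD FI FR) => //.
  by move=> x _ /=; rewrite ImM.
Qed.

Lemma cintegralZ D (k : R[i]) F : measurable D -> cintegrable D F ->
  cintegral D (fun x => k * F x) = k * cintegral D F.
Proof.
move=> mD [FR FI]; apply: complexP.
- rewrite ReM /= -mulNr -Rintegral_lin//.
  by apply: eq_Rintegral => x _; rewrite ReM mulNr.
- rewrite ImM /= -Rintegral_lin//.
  by apply: eq_Rintegral => x _; rewrite ImM.
Qed.

Lemma cintegrableN D F : measurable D -> cintegrable D F ->
  cintegrable D (fun x => - F x).
Proof.
move=> mD /(cintegrableZ (-1) mD); apply: eq_cintegrable => // x _.
by rewrite mulN1r.
Qed.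

Lemma cintegrableB D F G : measurable D -> cintegrable D F -> cintegrable D G ->
  cintegrable D (fun x => F x - G x).
Proof. by move=> mD iF /(cintegrableN mD); exact: cintegrableD. Qed.

Lemma cintegralB D F G : measurable D -> cintegrable D F -> cintegrable D G ->
  cintegral D (fun x => F x - G x) = cintegral D F - cintegral D G.
Proof.
move=> mD iF iG; rewrite cintegralD//; last exact: cintegrableN.
congr +%R; rewrite -mulN1r -cintegralZ//.
by apply: eq_cintegral => x _; rewrite mulN1r.
Qed.

Lemma cintegrable_sum D (I : Type) (s : seq I) (F : I -> T -> R[i]) :
  measurable D -> (forall i, cintegrable D (F i)) ->
  cintegrable D (fun x => \sum_(i <- s) F i x).
Proof.
move=> mD iF; elim: s => [|i s IH].
  split; apply: eq_integrable (integrable0 mu D) => // x _ /=;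
    by rewrite big_nil.
by apply: eq_cintegrable (cintegrableD mD (iF i) IH) => // x _; rewrite big_cons.
Qed.

Lemma cintegral_sum D (I : Type) (s : seq I) (F : I -> T -> R[i]) :
  measurable D -> (forall i, cintegrable D (F i)) ->
  cintegral D (fun x => \sum_(i <- s) F i x) = \sum_(i <- s) cintegral D (F i).
Proof.
move=> mD iF; elim: s => [|i s IH].
  rewrite big_nil; under eq_cintegral do rewrite big_nil.
  by apply: complexP; rewrite /= /Rintegral integral0.
rewrite big_cons -IH -cintegralD//; last exact: cintegrable_sum.
by apply: eq_cintegral => x _; rewrite big_cons.
Qed.

(** Estimating real and imaginary parts separately costs the factor 2. It is harmless, as the bound
    only serves to make integrals small. *)
Lemma cabs_cintegral_le D F (g : T -> R) : measurable D -> cintegrable D F ->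
  mu.-integrable D (EFin \o g) -> (forall x, D x -> cabs (F x) <= g x) ->
  cabs (cintegral D F) <= 2 * Rintegral mu D g.
Proof.
move=> mD [FR FI] ig Fg; rewrite (le_trans (cabs_le_ReIm _))//= mulr2n mulrDl mul1r.
have bd f : mu.-integrable D (EFin \o f) -> (forall x, D x -> `|f x| <= g x) ->
    `|Rintegral mu D f| <= Rintegral mu D g.
  move=> fi fg; rewrite (le_trans (le_normr_Rintegral mD fi))//.
  by apply: le_Rintegral => //; exact: integrable_norm.
by rewrite lerD// bd// => x Dx; rewrite (le_trans _ (Fg x Dx))// (norm_Re_le, norm_Im_le).
Qed.

Definition cmeasurable D F :=
  measurable_fun D (fun x => complex.Re (F x)) /\
  measurable_fun D (fun x => complex.Im (F x)).

Lemma le_cintegrable D F (g : T -> R) : measurable D -> cmeasurable D F ->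
  mu.-integrable D (EFin \o g) -> (forall x, D x -> cabs (F x) <= g x) ->
  cintegrable D F.
Proof.
move=> mD [mR mI] ig Fg.
have bd (f : T -> R) : measurable_fun D f -> (forall x, D x -> `|f x| <= g x) ->
    mu.-integrable D (EFin \o f).
  move=> mf fg; apply: le_integrable ig => //; first exact/measurable_EFinP.
  by move=> x Dx /=; rewrite lee_fin (le_trans _ (ler_norm _))// fg.
by split; apply: bd => // x Dx; rewrite (le_trans _ (Fg x Dx))// (norm_Re_le, norm_Im_le).
Qed.

End ComplexIntegral.

(** * Integrals over real segments *)

Section SegmentIntegral.
Variable R : realType.
Implicit Types (F : R -> R[i]) (a b c : R).
Local Notation mu := (@lebesgue_measure R).

Definition seg_integral a b F : R[i] := cintegral mu `[a, b] F.

(** Continuity is two-sided even at [a] and [b], so that it passes to subsegments without one-sided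
    limits. *)
Definition cpath_continuous a b F := forall x, a <= x <= b ->
  {for x, continuous (fun t => complex.Re (F t))} /\
  {for x, continuous (fun t => complex.Im (F t))}.

Lemma cpath_continuousB a b F G : cpath_continuous a b F ->
  cpath_continuous a b G -> cpath_continuous a b (fun x => F x - G x).
Proof.
move=> cF cG x xab; have [FR FI] := cF x xab; have [GR GI] := cG x xab.
split; rewrite /prop_for /continuous_at.
- rewrite ReD ReN; under eq_fun do rewrite ReD ReN; exact: cvgB.
- rewrite ImD ImN; under eq_fun do rewrite ImD ImN; exact: cvgB.
Qed.

Lemma ccontinuous_path (g : R[i] -> R[i]) (p : R -> R[i]) (x : R) :
  ccontinuous_at g (p x) ->
  (forall e : R, 0 < e -> \forall t \near x, cabs (p t - p x) < e) ->
  {for x, continuous (fun t => complex.Re (g (p t)))} /\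
  {for x, continuous (fun t => complex.Im (g (p t)))}.
Proof.
move=> cg cp; split; apply/cvgrPdist_le => e e0; have [d d0 hd] := cg e e0;
  near=> t.
- rewrite distrC -ReN -ReD (le_trans (norm_Re_le _))// hd//.
  by near: t; exact: cp.
- rewrite distrC -ImN -ImD (le_trans (norm_Im_le _))// hd//.
  by near: t; exact: cp.
Unshelve. all: by end_near. Qed.

Lemma cpath_integrable a b F : cpath_continuous a b F ->
  cintegrable mu `[a, b] F.
Proof.
move=> cF; split; apply: continuous_compact_integrable;
  try exact: segment_compact; apply: continuous_in_subspaceT => x;
  rewrite inE /= in_itv/= => /cF[]//.
Qed.

Lemma seg_integralB a b F G : cpath_continuous a b F ->
  cpath_continuous a b G ->
  seg_integral a b (fun x => F x - G x) = seg_integral a b F - seg_integral a b G.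
Proof. by move=> cF cG; apply: cintegralB => //; exact: cpath_integrable. Qed.

Lemma seg_integral_split a b c F : a <= b -> b <= c ->
  cpath_continuous a c F ->
  seg_integral a c F = seg_integral a b F + seg_integral b c F.
Proof.
move=> ab bc /cpath_integrable[iR iI].
have sp (f : R -> R) : mu.-integrable `[a, c] (EFin \o f) ->
    Rintegral mu `[a, c] f = Rintegral mu `[a, b] f + Rintegral mu `[b, c] f.
  move=> fi; apply/eqP; rewrite addrC -subr_eq; apply/eqP.
  rewrite Rintegral_itvB ?bnd_simp// Rintegral_itv_obnd_cbnd//.
  apply: integrableS fi => //; apply: subset_itv; rewrite bnd_simp//.
by apply: complexP; rewrite /= sp.
Qed.

Lemma seg_integral_cst a b (k : R[i]) : a <= b ->
  seg_integral a b (fun=> k) = k * (b - a)%:C%C.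
Proof.
move=> ab; apply: complexP; rewrite /= Rintegral_cst//= lebesgue_measure_itv/=;
  rewrite lte_fin reimE mulr0 ?subr0 ?add0r ?addr0;
  move: ab; rewrite le_eqVlt => /predU1P[->|->]; rewrite ?ltxx ?subrr ?mulr0//.
Qed.

Lemma cpath_continuous_cst a b (k : R[i]) : cpath_continuous a b (fun=> k).
Proof. by move=> x _; split; exact: cvg_cst. Qed.

(** The local estimate for Goursat's theorem, applied to differences of values on opposite sides of
    a small rectangle, which are nearly constant. *)
Lemma seg_integral_near_cst a b F (k : R[i]) (M : R) : a <= b ->
  cpath_continuous a b F -> (forall x, a <= x <= b -> cabs (F x - k) <= M) ->
  cabs (seg_integral a b F - k * (b - a)%:C%C) <= 2 * (M * (b - a)).
Proof.
move=> ab cF Fk; have ck := @cpath_continuous_cst a b k.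
rewrite -seg_integral_cst// -seg_integralB//.
apply: le_trans (@cabs_cintegral_le _ _ _ mu _ _ (fun=> M) _ _ _ _) _ => //.
- by apply: cpath_integrable; exact: cpath_continuousB.
- by apply: continuous_compact_integrable;
    [exact: segment_compact|move=> x; exact: cvg_cst].
rewrite Rintegral_cst//= lebesgue_measure_itv/= lte_fin.
by move: ab; rewrite le_eqVlt => /predU1P[->|->]; rewrite ?ltxx ?subrr ?mulr0.
Qed.

End SegmentIntegral.

(** * Contour integrals around rectangles *)

Section Goursat.
Variable R : realType.
Implicit Types (G : R[i] -> R[i]) (x y : R).

Definition ccontinuous_rect G x0 x1 y0 y1 := forall x y,
  x0 <= x <= x1 -> y0 <= y <= y1 -> ccontinuous_at G (Complex x y).

(** The counterclockwise integral of G dz, with opposite sides paired under one integral: bottom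
    minus top, and i times right minus left. *)
Definition rect_integral G x0 x1 y0 y1 : R[i] :=
  seg_integral x0 x1 (fun x => G (Complex x y0) - G (Complex x y1)) +
  'i%C * seg_integral y0 y1 (fun y => G (Complex x1 y) - G (Complex x0 y)).

Lemma cabs_real_sub (x x' y : R) :
  cabs (Complex x' y - Complex x y) = `|x' - x|.
Proof. by rewrite cabsE /cabs2 /= subrr expr0n addr0 sqrtr_sqr. Qed.

Lemma cabs_imag_sub (x y y' : R) :
  cabs (Complex x y' - Complex x y) = `|y' - y|.
Proof. by rewrite cabsE /cabs2 /= subrr expr0n add0r sqrtr_sqr. Qed.

Lemma near_dist_lt (x e : R) : 0 < e -> \forall t \near x, `|t - x| < e.
Proof.
by move=> e0; near=> t; rewrite distrC; near: t; exact: (@cvgr_dist_lt _ R _ _ _ id).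
Unshelve. all: by end_near. Qed.

Section Rectangle.
Variables (G : R[i] -> R[i]) (x0 x1 y0 y1 : R).
Hypothesis cG : ccontinuous_rect G x0 x1 y0 y1.

Lemma cpath_horizontal y : y0 <= y <= y1 ->
  cpath_continuous x0 x1 (fun x => G (Complex x y)).
Proof.
move=> yy x xx; apply: (@ccontinuous_path _ _ (fun x => Complex x y)).
  exact: cG.
move=> e e0; near=> t; rewrite cabs_real_sub.
by near: t; exact: near_dist_lt.
Unshelve. all: by end_near. Qed.

Lemma cpath_vertical x : x0 <= x <= x1 ->
  cpath_continuous y0 y1 (fun y => G (Complex x y)).
Proof.
move=> xx y yy; apply: (@ccontinuous_path _ _ (fun y => Complex x y)).
  exact: cG.
move=> e e0; near=> t; rewrite cabs_imag_sub.
by near: t; exact: near_dist_lt.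
Unshelve. all: by end_near. Qed.

(** The two halves traverse the vertical side at [x] in opposite directions, so its contributions
    cancel. *)
Lemma rect_integral_splitx x : x0 <= x <= x1 -> y0 <= y1 ->
  rect_integral G x0 x1 y0 y1 =
  rect_integral G x0 x y0 y1 + rect_integral G x x1 y0 y1.
Proof.
move=> /[dup] xx /andP[xx0 xx1] yy; rewrite /rect_integral.
have h0 := @cpath_horizontal y0; have h1 := @cpath_horizontal y1.
have v0 := @cpath_vertical x0; have v1 := @cpath_vertical x1.
have v := @cpath_vertical x.
rewrite !lexx ?yy ?(le_trans xx0 xx1) in h0 h1 v0 v1.
rewrite (seg_integral_split xx0 xx1); last first.
  by apply: cpath_continuousB; [exact: h0|exact: h1].
rewrite (@seg_integralB _ y0 y1)//; [|exact: v1|exact: v0].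
rewrite (@seg_integralB _ y0 y1)//; [|exact: v|exact: v0].
rewrite (@seg_integralB _ y0 y1)//; [|exact: v1|exact: v].
by ring.
Qed.

Lemma rect_integral_splity y : y0 <= y <= y1 -> x0 <= x1 ->
  rect_integral G x0 x1 y0 y1 =
  rect_integral G x0 x1 y0 y + rect_integral G x0 x1 y y1.
Proof.
move=> /[dup] yy /andP[yy0 yy1] xx; rewrite /rect_integral.
have h0 := @cpath_horizontal y0; have h1 := @cpath_horizontal y1.
have v0 := @cpath_vertical x0; have v1 := @cpath_vertical x1.
have h := @cpath_horizontal y.
rewrite !lexx ?xx ?(le_trans yy0 yy1) in h0 h1 v0 v1.
rewrite (seg_integral_split yy0 yy1); last first.
  by apply: cpath_continuousB; [exact: v1|exact: v0].
rewrite (@seg_integralB _ x0 x1)//; [|exact: h0|exact: h1].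
rewrite (@seg_integralB _ x0 x1)//; [|exact: h0|exact: h].
rewrite (@seg_integralB _ x0 x1)//; [|exact: h|exact: h1].
by ring.
Qed.

End Rectangle.

Lemma ccontinuous_rectW G x0 x1 y0 y1 x0' x1' y0' y1' :
  x0 <= x0' -> x1' <= x1 -> y0 <= y0' -> y1' <= y1 ->
  ccontinuous_rect G x0 x1 y0 y1 -> ccontinuous_rect G x0' x1' y0' y1'.
Proof.
move=> a b c d cG x y /andP[x0x x1x] /andP[y0y y1y]; apply: cG.
  by rewrite (le_trans a x0x) (le_trans x1x b).
by rewrite (le_trans c y0y) (le_trans y1y d).
Qed.

End Goursat.

(** * Goursat's theorem *)

Section GoursatTheorem.
Variable R : realType.
Implicit Types (G : R[i] -> R[i]) (x y a b : R).

Lemma pigeonhole2 (z z1 z2 : R[i]) : z = z1 + z2 ->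
  cabs z / 2 <= cabs z1 \/ cabs z / 2 <= cabs z2.
Proof.
move=> ->; have := le_cabsD z1 z2.
by case: (leP (cabs (z1 + z2) / 2) (cabs z1)) => [|h1]; [left|right; lra].
Qed.

(** The width is halved, then the height, each time keeping a half that carries at least half of the
    modulus. [p] is the lower left corner of the quarter that remains. *)
Lemma rect_integral_quarter G x y a b : 0 <= a -> 0 <= b ->
  ccontinuous_rect G x (x + a) y (y + b) ->
  exists p : R * R, [/\ x <= p.1 <= x + a / 2, y <= p.2 <= y + b / 2 &
    cabs (rect_integral G x (x + a) y (y + b)) / 4 <=
    cabs (rect_integral G p.1 (p.1 + a / 2) p.2 (p.2 + b / 2))].
Proof.
move=> a0 b0 cG.
have a20 : 0 <= a / 2 by rewrite divr_ge0.
have b20 : 0 <= b / 2 by rewrite divr_ge0.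
have xa : x + a = x + a / 2 + a / 2 by rewrite -addrA -splitr.
have yb : y + b = y + b / 2 + b / 2 by rewrite -addrA -splitr.
have hx : exists2 x', x <= x' <= x + a / 2 &
    cabs (rect_integral G x (x + a) y (y + b)) / 2 <=
    cabs (rect_integral G x' (x' + a / 2) y (y + b)).
  have [] := pigeonhole2 (@rect_integral_splitx _ _ _ _ _ _ cG (x + a / 2) _ _).
  - by rewrite lerDl a20 xa lerDl.
  - by rewrite lerDl.
  - by exists x; rewrite // lexx lerDl.
  - by rewrite {2}xa; exists (x + a / 2); rewrite // lexx andbT lerDl.
have [x' /andP[xx' x'x] hx'] := hx.
have quarter (u v w : R) : u / 2 <= v -> v / 2 <= w -> u / 4 <= w by lra.
have cG' : ccontinuous_rect G x' (x' + a / 2) y (y + b).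
  by apply: ccontinuous_rectW cG => //; rewrite xa lerD2r.
have [] := pigeonhole2 (@rect_integral_splity _ _ _ _ _ _ cG' (y + b / 2) _ _).
- by rewrite lerDl b20 yb lerDl.
- by rewrite lerDl.
- move=> h; exists (x', y); split; rewrite /= ?xx' ?lexx ?lerDl//.
  exact: quarter hx' h.
- rewrite {2}yb => h; exists (x', y + b / 2); split; rewrite /= ?xx' ?lexx ?lerDl// ?b20//.
  exact: quarter hx' h.
Qed.

(** Bisection keeps at least 4^-n of the modulus. Near the limit point the affine part of [G]
    integrates to 0, and the remainder is small compared with the size 2^-n of the rectangle, so its
    integral over sides of that size is small compared with 4^-n. *)
Lemma goursat G x0 x1 y0 y1 : x0 <= x1 -> y0 <= y1 ->
  (forall x y, x0 <= x <= x1 -> y0 <= y <= y1 ->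
     exists c, has_cderiv G (Complex x y) c) ->
  rect_integral G x0 x1 y0 y1 = 0.
Proof.
move=> x01 y01 dG.
set a := x1 - x0; set b := y1 - y0.
have a0 : 0 <= a by rewrite subr_ge0.
have b0 : 0 <= b by rewrite subr_ge0.
have cG : ccontinuous_rect G x0 x1 y0 y1.
  by move=> x y xx yy; have [c] := dG x y xx yy; exact: has_cderiv_continuous.
set K := cabs (rect_integral G x0 x1 y0 y1).
pose ok n (p : R * R) := [/\ x0 <= p.1, p.1 + a / 2 ^+ n <= x1, y0 <= p.2,
  p.2 + b / 2 ^+ n <= y1 & K / 4 ^+ n <=
  cabs (rect_integral G p.1 (p.1 + a / 2 ^+ n) p.2 (p.2 + b / 2 ^+ n))].
have p2 n : 0 < 2 ^+ n :> R by rewrite exprn_gt0.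
(* The implication sits under the existential, so that [choice] yields a successor defined on all
   pairs. *)
have step (np : nat * (R * R)) : exists q, ok np.1 np.2 ->
    ok np.1.+1 q /\ (np.2.1 <= q.1 <= np.2.1 + a / 2 ^+ np.1.+1 /\
    np.2.2 <= q.2 <= np.2.2 + b / 2 ^+ np.1.+1).
  case: np => n [x y] /=.
  have [[/= okx okx' oky oky' okK]|nok] := pselect (ok n (x, y)); last by exists (x, y).
  have [|||p [p1 p2' pK]] := @rect_integral_quarter G x y (a / 2 ^+ n) (b / 2 ^+ n).
  - by rewrite divr_ge0// ltW.
  - by rewrite divr_ge0// ltW.
  - exact: ccontinuous_rectW cG.
  have half (c : R) : c / 2 ^+ n / 2 = c / 2 ^+ n.+1.
    by rewrite exprSr -mulrA -invfM.
  rewrite !half in p1 p2' pK; exists p => _; split => //.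
  have half' (c : R) : c / 2 ^+ n = c / 2 ^+ n.+1 + c / 2 ^+ n.+1.
    by rewrite -half -splitr.
  rewrite (half' a) in okx'; rewrite (half' b) in oky'.
  case/andP: p1 => p11 p12; case/andP: p2' => p21 p22; split; try lra.
  by apply: le_trans pK; rewrite exprSr invfM mulrA ler_pM2r ?invr_gt0.
have [f hf] := choice step.
pose s := fix s n := if n is m.+1 then f (m, s m) else (x0, y0).
have sok n : ok n (s n).
  elim: n => [|n IH]; last by have [] := hf (n, s n) IH.
  have x0a : x0 + a = x1 by rewrite /a; ring.
  have y0b : y0 + b = y1 by rewrite /b; ring.
  by rewrite /ok /= !expr0 !divr1 x0a y0b; split.
have snext n : (s n).1 <= (s n.+1).1 <= (s n).1 + a / 2 ^+ n.+1 /\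
    (s n).2 <= (s n.+1).2 <= (s n).2 + b / 2 ^+ n.+1.
  by have [] := hf (n, s n) (sok n).
(* One coordinate of the nested rectangles: the limit is the supremum of the lower ends, and every
   upper end bounds it. *)
have nested (t : nat -> R) (c : R) :
    (forall n, t n <= t n.+1 <= t n + c / 2 ^+ n.+1) ->
    exists X, forall n, t n <= X <= t n + c / 2 ^+ n.
  move=> ht.
  have up n k : t n <= t (k + n)%N.
    elim: k => [|k IH]; first by rewrite add0n.
    by rewrite addSn (le_trans IH)//; case/andP: (ht (k + n)%N).
  have dn n k : t (k + n)%N + c / 2 ^+ (k + n) <= t n + c / 2 ^+ n.
    elim: k => [|k IH]; first by rewrite add0n.
    rewrite addSn (le_trans _ IH)//; case/andP: (ht (k + n)%N) => _.
    have -> : c / 2 ^+ (k + n) = c / 2 ^+ (k + n).+1 + c / 2 ^+ (k + n).+1.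
      by rewrite exprSr invfM mulrA -splitr.
    lra.
  have c0 : 0 <= c.
    have /andP[h1 h2] := ht 0%N; have := le_trans h1 h2.
    by rewrite lerDl pmulr_lge0// invr_gt0.
  have ub n m : t m <= t n + c / 2 ^+ n.
    apply: (le_trans (up m n)); rewrite addnC; apply: le_trans (dn n m).
    by rewrite lerDl divr_ge0// ltW.
  have hs : has_sup (range t).
    by split; [exists (t 0%N), 0%N|exists (t 0%N + c / 2 ^+ 0) => _ [m _ <-]].
  exists (sup (range t)) => n; apply/andP; split.
    by apply: ub_le_sup; [case: hs|exists n].
  by apply: ge_sup; [case: hs|move=> _ [m _ <-]].
have [X hX] := nested _ _ (fun n => (snext n).1).
have [Y hY] := nested _ _ (fun n => (snext n).2).
have [h1 h2 h3 h4 _] := sok 0%N.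
have /andP[X1 X2] := hX 0%N; have /andP[Y1 Y2] := hY 0%N.
have [||c hc] := dG X Y.
  by rewrite (le_trans h1)// (le_trans X2).
  by rewrite (le_trans h3)// (le_trans Y2).
have ab0 : 0 <= a + b by rewrite addr_ge0.
(* Of the 4, one factor 2 comes from estimating real and imaginary parts separately, the other from
   pairing opposite sides. *)
suff Ke e : 0 < e -> K <= 4 * e * (a + b) ^+ 2.
  apply/eqP; rewrite -cabs_eq0 eq_le cabs_ge0 andbT -/K.
  apply/ler_addgt0Pr => e e0; rewrite add0r.
  have k0 : 0 < 1 + 4 * (a + b) ^+ 2 by rewrite ltr_pwDl// mulr_ge0// sqr_ge0.
  apply: le_trans (Ke (e / (1 + 4 * (a + b) ^+ 2)) _) _; first by rewrite divr_gt0.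
  rewrite (_ : 4 * _ * _ = e * (4 * (a + b) ^+ 2 / (1 + 4 * (a + b) ^+ 2))); last by ring.
  by rewrite ler_piMr ?(ltW e0)// ler_pdivrMr// mul1r lerDr.
move=> e0; have [d d0 hd] := hc e e0.
have [n ndlt] : exists n, (a + b) / 2 ^+ n < d.
  have : ((a + b) / 2 ^+ n) @[n --> \oo] --> (0 : R).
    rewrite -(mulr0 (a + b)); apply: cvgM; first exact: cvg_cst.
    under eq_fun do rewrite -exprVn.
    by apply: cvg_expr; rewrite ger0_norm ?invr_ge0// invf_lt1// ltr1n.
  by move=> /cvgr_lt /(_ _ d0) [n _ /(_ n (leqnn n))]; exists n.
have [k1 k2 k3 k4 kK] := sok n.
set x := (s n).1 in k1 k2 kK *; set y := (s n).2 in k3 k4 kK *.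
set an := a / 2 ^+ n in k2 kK *; set bn := b / 2 ^+ n in k4 kK *.
have an0 : 0 <= an by rewrite divr_ge0// ltW.
have bn0 : 0 <= bn by rewrite divr_ge0// ltW.
have eab : (a + b) / 2 ^+ n = an + bn by rewrite mulrDl.
rewrite eab in ndlt.
have /andP[Xx1 Xx2] : x <= X <= x + an := hX n.
have /andP[Yy1 Yy2] : y <= Y <= y + bn := hY n.
pose E v := G v - G (Complex X Y) - c * (v - Complex X Y).
have hE u v : x <= u <= x + an -> y <= v <= y + bn ->
    cabs (E (Complex u v)) <= e * (an + bn).
  move=> /andP[u1 u2] /andP[v1 v2].
  have uv : cabs (Complex u v - Complex X Y) <= an + bn.
    by rewrite (le_trans (cabs_le_ReIm _))// lerD//= ler_norml; lra.
  rewrite (le_trans (hd _ _)) ?(le_lt_trans uv)//.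
  by rewrite ler_wpM2l// ltW.
have cGn : ccontinuous_rect G x (x + an) y (y + bn) by exact: ccontinuous_rectW cG.
have yin : y <= y <= y + bn by rewrite lexx lerDl.
have yin' : y <= y + bn <= y + bn by rewrite lexx andbT lerDl.
have xin : x <= x <= x + an by rewrite lexx lerDl.
have xin' : x <= x + an <= x + an by rewrite lexx andbT lerDl.
have bdE z w : cabs z <= e * (an + bn) -> cabs w <= e * (an + bn) ->
    cabs (z - w) <= 2 * e * (an + bn).
  by move=> hz hw; rewrite (le_trans (le_cabsB _ _))//; lra.
(* For the affine part, bottom minus top is the constant -i c bn and right minus left is c an; in
   the contour sum -i c bn an and i c an bn cancel. *)
have hor := @seg_integral_near_cst _ x (x + an)
  (fun u => G (Complex u y) - G (Complex u (y + bn))) (c * - ('i%C * bn%:C%C))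
  (2 * e * (an + bn)).
have ver := @seg_integral_near_cst _ y (y + bn)
  (fun v => G (Complex (x + an) v) - G (Complex x v)) (c * an%:C%C)
  (2 * e * (an + bn)).
have {}hor := hor ltac:(by rewrite lerDl)
   (cpath_continuousB (cpath_horizontal cGn yin) (cpath_horizontal cGn yin')).
have {}ver := ver ltac:(by rewrite lerDl)
   (cpath_continuousB (cpath_vertical cGn xin') (cpath_vertical cGn xin)).
have {}hor : cabs (seg_integral x (x + an) (fun u => G (Complex u y) -
    G (Complex u (y + bn))) - c * - ('i%C * bn%:C%C) * an%:C%C) <=
    2 * (2 * e * (an + bn) * an).
  rewrite [X in 2 * (_ * X)](_ : an = x + an - x); last by ring.
  rewrite [X in c * _ * X%:C%C](_ : an = x + an - x); last by ring.
  apply: hor => u xu; cbv beta; rewrite (_ : _ - _ = E (Complex u y) - E (Complex u (y + bn))).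
    by apply: bdE; exact: hE.
  have -> : 'i%C * bn%:C%C = Complex u (y + bn) - Complex u y.
    by rewrite -Complex_im ComplexB subrr (addrAC y) subrr add0r.
  by rewrite /E; ring.
have {}ver : cabs (seg_integral y (y + bn) (fun v => G (Complex (x + an) v) -
    G (Complex x v)) - c * an%:C%C * bn%:C%C) <=
    2 * (2 * e * (an + bn) * bn).
  rewrite [X in 2 * (_ * X)](_ : bn = y + bn - y); last by ring.
  rewrite [X in c * _ * X%:C%C](_ : bn = y + bn - y); last by ring.
  apply: ver => v yv; cbv beta; rewrite (_ : _ - _ = E (Complex (x + an) v) - E (Complex x v)).
    by apply: bdE; exact: hE.
  have -> : an%:C%C = Complex (x + an) v - Complex x v.
    by rewrite ComplexB subrr (addrAC x) subrr add0r.
  by rewrite /E; ring.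
have bound : cabs (rect_integral G x (x + an) y (y + bn)) <= 4 * e * (an + bn) ^+ 2.
  rewrite /rect_integral.
  move: hor ver; set I1 := seg_integral _ _ _; set I2 := seg_integral _ _ _.
  move=> hor ver.
  rewrite (_ : _ + _ = (I1 - c * - ('i%C * bn%:C%C) * an%:C%C) +
     'i%C * (I2 - c * an%:C%C * bn%:C%C)); last by ring.
  rewrite (le_trans (le_cabsD _ _))// cabsM cabs_i mul1r (le_trans (lerD hor ver))//.
  by rewrite le_eqVlt; apply/orP; left; apply/eqP; ring.
have := le_trans kK bound; rewrite -eab expr_div_n ler_pdivrMr ?exprn_gt0//.
rewrite (_ : 4 ^+ n = (2 ^+ n) ^+ 2 :> R); last first.
  by rewrite -exprM mulnC exprM; congr (_ ^+ n); ring.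
by rewrite -[leRHS]mulrA divfK// gt_eqF// exprn_gt0.
Qed.

End GoursatTheorem.

(** * Circle means and Cauchy's formula *)

Section CircleMeans.
Variable R : realType.
Implicit Types (h f : R[i] -> R[i]) (r t : R) (a z : R[i]).
Local Notation mu := (@lebesgue_measure R).

Definition circle_point r t : R[i] := Complex (r * cos t) (r * sin t).

(** This is 2 pi times the mean, that is, the contour integral of h(z) / (i z) dz. Cauchy kernels
    therefore carry an extra factor z below. *)
Definition circle_integral h r : R[i] :=
  seg_integral 0 (pi *+ 2) (fun t => h (circle_point r t)).

Lemma circle_pointM r s t : circle_point (s * r) t = s%:C%C * circle_point r t.
Proof.
by apply: complexP; rewrite !reimE !mul0r ?subr0 ?addr0 mulrA.
Qed.

Lemma circle_pointE r t : circle_point r t = r%:C%C * circle_point 1 t.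
Proof. by rewrite -circle_pointM mulr1. Qed.

Lemma cabs_circle_point1 t : cabs (circle_point 1 t) = 1.
Proof. by rewrite cabsE /cabs2 /= !mul1r cos2Dsin2 sqrtr1. Qed.

Lemma cabs_circle_point r t : cabs (circle_point r t) = `|r|.
Proof. by rewrite circle_pointE cabsM cabsC cabs_circle_point1 mulr1. Qed.

Lemma near_circle_point_angle r t (e : R) : 0 < e ->
  \forall s \near t, cabs (circle_point r s - circle_point r t) < e.
Proof.
move=> e0; have k0 : 0 < 2 * (1 + `|r|) by rewrite mulr_gt0// ltr_pwDl.
have d0 : 0 < e / (2 * (1 + `|r|)) by rewrite divr_gt0.
near=> s.
rewrite circle_pointE (circle_pointE r t) -mulrBr cabsM cabsC.
have : `|cos t - cos s| < e / (2 * (1 + `|r|)).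
  by near: s; apply: cvgr_dist_lt => //; exact: continuous_cos.
have : `|sin t - sin s| < e / (2 * (1 + `|r|)).
  by near: s; apply: cvgr_dist_lt => //; exact: continuous_sin.
rewrite !ltr_pdivlMr// => h1 h2.
have /= := cabs_le_ReIm (circle_point 1 s - circle_point 1 t).
rewrite !mul1r (distrC (cos s)) (distrC (sin s)) => h3.
apply: le_lt_trans (_ : (1 + `|r|) * (`|cos t - cos s| + `|sin t - sin s|) < _).
  by rewrite ler_pM ?cabs_ge0// lerDr.
by lra.
Unshelve. all: by end_near. Qed.


Lemma cpath_circle h r :
  (forall z, cabs z = `|r| -> ccontinuous_at h z) ->
  cpath_continuous 0 (pi *+ 2) (fun t => h (circle_point r t)).
Proof.
move=> ch t _; apply: (@ccontinuous_path _ _ (circle_point r)).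
  by apply: ch; exact: cabs_circle_point.
exact: near_circle_point_angle.
Qed.

Lemma pi2_ge0 : 0 <= pi *+ 2 :> R.
Proof. by rewrite mulrn_wge0// pi_ge0. Qed.

(** Goursat's theorem for h(exp(x + i y)) on [ln r1, ln r2] x [0, 2 pi]: the horizontal sides cancel
    by periodicity of exp, and the vertical sides are the two circle integrals. *)
Lemma circle_integral_const h (A B r1 r2 : R) : 0 <= A ->
  (forall z, A < cabs z -> cabs z < B -> exists c, has_cderiv h z c) ->
  A < r1 -> r1 <= r2 -> r2 < B -> circle_integral h r1 = circle_integral h r2.
Proof.
move=> A0 dh Ar1 r12 r2B.
have r10 : 0 < r1 by exact: le_lt_trans Ar1.
have r20 : 0 < r2 by exact: lt_le_trans r12.
have e1 : expR (ln r1) = r1 by rewrite lnK.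
have e2 : expR (ln r2) = r2 by rewrite lnK.
have dG x y : ln r1 <= x <= ln r2 -> 0 <= y <= pi *+ 2 ->
    exists c, has_cderiv (h \o @cexp R) (Complex x y) c.
  move=> /andP[x1 x2] _.
  have [||c hc] := dh (cexp (Complex x y)).
  - by rewrite cabs_cexp (lt_le_trans Ar1)// -{1}e1 ler_expR.
  - by rewrite cabs_cexp (le_lt_trans _ r2B)// -{1}e2 ler_expR.
  by exists (c * cexp (Complex x y)); apply: has_cderiv_comp => //; exact: cexp_has_cderiv.
have ln12 : ln r1 <= ln r2 by rewrite ler_ln.
have cG : ccontinuous_rect (h \o @cexp R) (ln r1) (ln r2) 0 (pi *+ 2).
  by move=> x y xx yy; have [c] := dG x y xx yy; exact: has_cderiv_continuous.
have := goursat ln12 pi2_ge0 dG; rewrite /rect_integral.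
have -> : seg_integral (ln r1) (ln r2) (fun x => (h \o @cexp R) (Complex x 0) -
    (h \o @cexp R) (Complex x (pi *+ 2))) = 0.
  rewrite -(mul0r (ln r2 - ln r1)%:C%C) -seg_integral_cst//.
  apply: eq_cintegral => x _.
  by rewrite /= /cexp /= cos0 sin0 cos2pi sin2pi subrr.
rewrite add0r seg_integralB; last 2 first.
- by apply: cpath_vertical cG _ _; rewrite lexx andbT.
- by apply: cpath_vertical cG _ _; rewrite lexx.
have circE x r : expR x = r -> seg_integral 0 (pi *+ 2)
    (fun y => (h \o @cexp R) (Complex x y)) = circle_integral h r.
  by move=> <-.
rewrite (circE _ _ e1) (circE _ _ e2) => /eqP.
rewrite mulf_eq0 subr_eq0 -cabs_eq0 cabs_i oner_eq0/= => /eqP.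
by [].
Qed.

(** The closed disc is read in [R * R], where it is compact as a closed part of a square. *)
Lemma bounded_on_disc h (b B : R) : 0 <= b -> b < B ->
  (forall z, cabs z < B -> ccontinuous_at h z) ->
  exists M, forall z, cabs z <= b -> cabs (h z) <= M.
Proof.
move=> b0 bB ch.
pose C2 (p : R * R) : R[i] := Complex p.1 p.2.
pose K := [set p | cabs2 (C2 p) <= b ^+ 2].
have leK p : K p = (cabs (C2 p) <= b) :> Prop.
  rewrite /K /= -sqr_cabs; congr is_true.
  by rewrite ler_pXn2r// ?nnegrE ?cabs_ge0.
have cC (p : R * R) : {for p, continuous (fun q : R * R => cabs2 (C2 q))}.
  by rewrite /prop_for /continuous_at; apply: cvgD; apply: cvgM;
    (exact: cvg_fst || exact: cvg_snd).
have compK : compact K.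
  apply: (@subclosed_compact _ _ (`[-b, b] `*` `[-b, b])).
  - rewrite (_ : K = (fun q => cabs2 (C2 q)) @^-1` [set x | x <= b ^+ 2]) //.
    by apply: preimage_closed; [move=> p _; exact: cC|exact: closed_le].
  - by apply: compact_setX; exact: segment_compact.
  - move=> p; rewrite leK => pb; split; rewrite /= in_itv/= -ler_norml.
      by rewrite (le_trans (norm_Re_le (C2 p))).
    by rewrite (le_trans (norm_Im_le (C2 p))).
have cH : {within K, continuous (fun p => cabs (h (C2 p)))}.
  apply: continuous_in_subspaceT => p; rewrite inE leK => pb.
  apply/cvgrPdist_le => e e0.
  have [d d0 hd] := ch (C2 p) (le_lt_trans pb bB) e e0.
  have d20 : 0 < d / 2 by rewrite divr_gt0.
  near=> q.
  have qp : cabs (C2 q - C2 p) < d.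
    rewrite (le_lt_trans (cabs_le_ReIm _))//= (splitr d) ltrD//.
      rewrite distrC; near: q; apply: cvgr_dist_lt => //; exact: cvg_fst.
    rewrite distrC; near: q; apply: cvgr_dist_lt => //; exact: cvg_snd.
  have := hd _ qp.
  have := cabs_sub_le (h (C2 q)) (h (C2 p)).
  have := cabs_sub_le (h (C2 p)) (h (C2 q)).
  rewrite (cabs_distC (h (C2 p))) => h1 h2 h3.
  by rewrite ler_norml; apply/andP; split; lra.
have K0 : K !=set0.
  by exists (0, 0); rewrite leK (_ : C2 (0, 0) = 0)// cabs0.
have [p _ hp] := compact_EVT_max K0 compK cH.
exists (cabs (h (C2 p))) => -[x y] xyb.
by apply: (hp (x, y)); rewrite inE leK.
Unshelve. all: by end_near. Qed.

Lemma circle_integral_continuous h (B r : R) : `|r| < B ->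
  (forall z, cabs z < B -> ccontinuous_at h z) ->
  {for r, continuous (fun s => complex.Re (circle_integral h s))} /\
  {for r, continuous (fun s => complex.Im (circle_integral h s))}.
Proof.
move=> rB ch.
pose b := (`|r| + B) / 2.
have rb : `|r| < b by rewrite /b; lra.
have bB : b < B by rewrite /b; lra.
have b0 : 0 <= b by rewrite (le_trans _ (ltW rb)).
have [M hM] := bounded_on_disc b0 bB ch.
have inb s : `]-b, b[%classic s -> `|s| < b.
  by rewrite /= in_itv/= ltr_norml.
have ri : r \in `]-b, b[%classic by rewrite inE/= in_itv/= -ltr_norml.
have cint s : `]-b, b[%classic s -> cintegrable mu `[0, pi *+ 2]
    (fun t => h (circle_point s t)).
  move=> /inb sb; apply: cpath_integrable; apply: cpath_circle => z zs.
  by apply: ch; rewrite zs (lt_trans sb).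
have crad t s : `]-b, b[%classic s ->
    {for s, continuous (fun s' => complex.Re (h (circle_point s' t)))} /\
    {for s, continuous (fun s' => complex.Im (h (circle_point s' t)))}.
  move=> /inb sb; apply: (@ccontinuous_path _ _ (fun s' => circle_point s' t)).
    by apply: ch; rewrite cabs_circle_point (lt_trans sb).
  move=> e e0; near=> s'.
  rewrite circle_pointE (circle_pointE s) -mulrBl -rmorphB cabsM cabsC.
  rewrite cabs_circle_point1 mulr1; near: s'; exact: near_dist_lt.
have iM : mu.-integrable `[0, pi *+ 2] (EFin \o (fun=> M)).
  by apply: continuous_compact_integrable;
    [exact: segment_compact|move=> x; exact: cvg_cst].
have hMb s t : `]-b, b[%classic s -> cabs (h (circle_point s t)) <= M.
  by move=> /inb /ltW sb; apply: hM; rewrite cabs_circle_point.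
split.
- apply: (@continuity_under_integral _ _ _ mu
    (fun s t => complex.Re (h (circle_point s t))) `[0, pi *+ 2] _ (-b) b _ _
    (fun=> M)) => //.
  + by move=> s /cint[].
  + by apply: aeW => t _ s; rewrite inE => /(crad t)[].
  + by move=> s sb; apply: aeW => t _; rewrite (le_trans (norm_Re_le _))// hMb.
- apply: (@continuity_under_integral _ _ _ mu
    (fun s t => complex.Im (h (circle_point s t))) `[0, pi *+ 2] _ (-b) b _ _
    (fun=> M)) => //.
  + by move=> s /cint[].
  + by apply: aeW => t _ s; rewrite inE => /(crad t)[].
  + by move=> s sb; apply: aeW => t _; rewrite (le_trans (norm_Im_le _))// hMb.
Unshelve. all: by end_near. Qed.

End CircleMeans.

(** * Cauchy's formula and polynomial approximation on smaller discs *)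

Section CauchyFormula.
Variable R : realType.
Implicit Types (h f g : R[i] -> R[i]) (r t : R) (a z c : R[i]).
Local Notation mu := (@lebesgue_measure R).

Definition cderivable f z := derivable (f : R[i]^o -> R[i]^o) z 1.

Lemma cderivable_ex f z : cderivable f z -> exists c, has_cderiv f z c.
Proof. by move=> /derivable_has_cderiv df; eexists; exact: df. Qed.

Lemma has_cderiv_near f g z c (d : R) : 0 < d ->
  (forall v, cabs (v - z) < d -> f v = g v) ->
  has_cderiv f z c -> has_cderiv g z c.
Proof.
move=> d0 fg hf e e0; have [d' d'0 hd'] := hf e e0.
exists (Num.min d d'); first by rewrite lt_min d0.
by move=> v; rewrite lt_min => /andP[vd /hd']; rewrite !fg// subrr cabs0.
Qed.

(** Carries a constant value of the circle integral over to an endpoint of the interval of radii on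
    which it is known. *)
Lemma continuous_adherent_value (phi : R -> R) (x k : R) :
  {for x, continuous phi} ->
  (forall e : R, 0 < e -> exists2 t, `|t - x| < e & phi t = k) -> phi x = k.
Proof.
move=> /cvgrPdist_le cphi hk; apply/eqP; rewrite -subr_eq0 -normr_le0.
apply/ler_addgt0Pr => e e0; rewrite add0r.
have [/= d d0 hd] := cphi e e0.
have [t td <-] := hk d d0.
by apply: hd; rewrite /ball_ /= distrC.
Qed.

(* As a function of [r] the integral is continuous, vanishes at [0], and is constant
   between the radii [0] and [cabs a], and beyond [cabs a]. *)
Lemma circle_difference_quotient f (B r : R) a :
  (forall z, cabs z < B -> cderivable f z) -> cabs a < r -> r < B ->
  circle_integral (fun z => z * (f z - f a) / (z - a)) r = 0.
Proof.
move=> df ar rB; have aB := lt_trans ar rB.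
have [c hc] := cderivable_ex (df a aB).
pose h0 z := z * (f z - f a) / (z - a).
(* The singularity is filled with the limit a f'(a). This makes [h] continuous at [a];
   differentiability there is not claimed. *)
pose h z := if z == a then a * c else h0 z.
have dh z : cabs z < B -> z != a -> exists c, has_cderiv h z c.
  move=> zB za; have : cderivable h0 z.
    apply: derivableM; [apply: derivableM|apply: derivableV].
    - exact: derivable_id.
    - by apply: derivableB; [exact: df|exact: derivable_cst].
    - by rewrite subr_eq0.
    - by apply: derivableB; [exact: derivable_id|exact: derivable_cst].
  move=> /cderivable_ex[k hk]; exists k.
  apply: (@has_cderiv_near h0 h z k (cabs (z - a))) hk.
    by rewrite cabs_gt0 subr_eq0.
  move=> v vz; rewrite /h; case: eqVneq => // va.
  by move: vz; rewrite va cabs_distC ltxx.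
have ch z : cabs z < B -> ccontinuous_at h z.
  move=> zB; have [->|/(dh z zB)[k]] := eqVneq z a; last exact: has_cderiv_continuous.
  move=> e e0.
  have k0 : 0 < 2 * (1 + cabs a) by rewrite mulr_gt0// ltr_pwDl// cabs_ge0.
  have k1 : 0 < 2 * (1 + cabs c) by rewrite mulr_gt0// ltr_pwDl// cabs_ge0.
  have [d d0 hd] := hc (Num.min 1 (e / (2 * (1 + cabs a)))) ltac:(by rewrite lt_min ltr01 divr_gt0).
  exists (Num.min (Num.min 1 d) (e / (2 * (1 + cabs c)))).
    by rewrite !lt_min ltr01 d0 divr_gt0.
  move=> v; rewrite !lt_min => /andP[/andP[v1 /hd {}hd] vc].
  rewrite /h eqxx; case: eqVneq => [_|va]; first by rewrite subrr cabs0 ltW.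
  have va0 : v - a != 0 by rewrite subr_eq0.
  have q : cabs ((f v - f a) / (v - a) - c) <= Num.min 1 (e / (2 * (1 + cabs a))).
    rewrite (_ : _ - c = (f v - f a - c * (v - a)) / (v - a)); last first.
      by rewrite [RHS]mulrBl mulfK.
    by rewrite cabsM cabsV ler_pdivrMr ?cabs_gt0.
  rewrite (_ : _ - _ = v * ((f v - f a) / (v - a) - c) + c * (v - a)); last first.
    by rewrite /h0; ring.
  rewrite (le_trans (le_cabsD _ _))// !cabsM (splitr e) lerD//.
    have va1 : cabs v <= 1 + cabs a.
      rewrite -(subrK a v) (le_trans (le_cabsD _ _))// lerD2r ltW//.
    move: q; rewrite le_min => /andP[_]; rewrite ler_pdivlMr// => q2.
    have : cabs v * cabs ((f v - f a) / (v - a) - c) <=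
      (1 + cabs a) * cabs ((f v - f a) / (v - a) - c) by rewrite ler_wpM2r ?cabs_ge0.
    by lra.
  move: vc; rewrite ltr_pdivlMr// => vc.
  have : cabs c * cabs (v - a) <= (1 + cabs c) * cabs (v - a).
    by rewrite ler_wpM2r ?cabs_ge0// lerDr.
  by lra.
have -> : circle_integral (fun z => z * (f z - f a) / (z - a)) r = circle_integral h r.
  apply: eq_cintegral => t _; rewrite /h; case: eqVneq => // ha; move: ar.
  rewrite -ha cabs_circle_point ltNge ler_norm//.
have r0 : 0 < r by rewrite (le_lt_trans _ ar)// cabs_ge0.
pose J := circle_integral h.
have Jlim s k : 0 <= s -> s < B -> (forall e : R, 0 < e ->
    exists2 t, `|t - s| < e & J t = k) -> J s = k.
  move=> s0 sB hk.
  have [cR cI] := @circle_integral_continuous _ h B s ltac:(by rewrite ger0_norm) ch.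
  apply: complexP.
    by apply: continuous_adherent_value cR _ => e /hk[t ts <-]; exists t.
  by apply: continuous_adherent_value cI _ => e /hk[t ts <-]; exists t.
(* The factor z makes [h] vanish at the centre, also when [a] is the centre. *)
have J0 : J 0 = 0.
  rewrite /J /circle_integral -(mul0r (pi *+ 2 - 0)%:C%C) -seg_integral_cst ?pi2_ge0//.
  apply: eq_cintegral => t _.
  have -> : circle_point 0 t = 0 :> R[i] by rewrite circle_pointE rmorph0 mul0r.
  by rewrite /h /h0; case: eqVneq => [<-|]; rewrite !mul0r.
have Ja : J (cabs a) = 0.
  have [a0|a0] := eqVneq (cabs a) 0; first by rewrite a0.
  have {}a0 : 0 < cabs a by rewrite lt_neqAle eq_sym a0 cabs_ge0.
  have Jin s t : 0 < s -> s <= t -> t < cabs a -> J s = J t.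
    move=> s0 st ta; apply: (@circle_integral_const _ h 0 (cabs a)) => // z z0 za.
    apply: dh; first exact: lt_trans aB.
    by apply: contraTneq za => ->; rewrite ltxx.
  have Jin0 t : 0 < t -> t < cabs a -> J t = 0.
    move=> t0 ta; rewrite -J0; apply/esym; apply: Jlim => //.
      exact: le_lt_trans (cabs_ge0 a) aB.
    move=> e e0; exists (Num.min t (e / 2)).
      have e20 : 0 < e / 2 by rewrite divr_gt0.
      rewrite subr0 ger0_norm; last by rewrite le_min !ltW.
      by rewrite gt_min; apply/orP; right; lra.
    by apply: Jin => //; rewrite ?lt_min ?t0 ?divr_gt0// ge_min lexx.
  apply: (Jlim _ _ (cabs_ge0 a)) => // e e0.
  have e20 : 0 < e / 2 by rewrite divr_gt0.
  (* The maximum with half the radius keeps the sample radius positive, where [Jin0] applies. *)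
  exists (Num.max (cabs a / 2) (cabs a - e / 2)).
    rewrite ler0_norm; last by rewrite subr_le0 ge_max; apply/andP; split; lra.
    have : cabs a - e / 2 <= Num.max (cabs a / 2) (cabs a - e / 2) by rewrite le_max lexx orbT.
    by lra.
  apply: Jin0; first by rewrite lt_max divr_gt0.
  by rewrite gt_max; apply/andP; split; lra.
rewrite -/(J r) -Ja; apply/esym; apply: (Jlim _ _ (cabs_ge0 a)) => // e e0.
pose t := Num.min r (cabs a + e / 2).
have ta : cabs a < t by rewrite lt_min ar ltrDl divr_gt0.
exists t.
  rewrite gtr0_norm ?subr_gt0//.
  have : t <= cabs a + e / 2 by rewrite /t ge_min lexx orbT.
  by lra.
have tr : t <= r by rewrite /t ge_min lexx.
apply: (@circle_integral_const _ h (cabs a) B) => //; first exact: cabs_ge0.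
move=> z za zB; apply: dh => //.
by apply: contraTneq za => ->; rewrite ltxx.
Qed.

Definition circle_integrable h r :=
  cintegrable mu `[0, pi *+ 2] (fun t => h (circle_point r t)).

Let mI : measurable (`[0, pi *+ 2] : set (measurableTypeR R)).
Proof. exact: measurable_itv. Qed.

Lemma cderivable_circle_integrable h r :
  (forall z, cabs z = `|r| -> cderivable h z) -> circle_integrable h r.
Proof.
move=> dh; apply/cpath_integrable/cpath_circle => z /dh/cderivable_ex[c].
exact: has_cderiv_continuous.
Qed.

Lemma eq_circle_integral h g r : (forall z, cabs z = `|r| -> h z = g z) ->
  circle_integral h r = circle_integral g r.
Proof.
by move=> hg; apply: eq_cintegral => t _; apply: hg; exact: cabs_circle_point.
Qed.

Lemma circle_integrableZ c h r : circle_integrable h r ->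
  circle_integrable (fun z => c * h z) r.
Proof. exact: cintegrableZ mI. Qed.

Lemma circle_integralZ c h r : circle_integrable h r ->
  circle_integral (fun z => c * h z) r = c * circle_integral h r.
Proof. exact: cintegralZ mI. Qed.

Lemma circle_integrableB h g r : circle_integrable h r -> circle_integrable g r ->
  circle_integrable (fun z => h z - g z) r.
Proof. exact: cintegrableB mI. Qed.

Lemma circle_integralB h g r : circle_integrable h r -> circle_integrable g r ->
  circle_integral (fun z => h z - g z) r = circle_integral h r - circle_integral g r.
Proof. exact: cintegralB mI. Qed.

Lemma circle_integralD h g r : circle_integrable h r -> circle_integrable g r ->
  circle_integral (fun z => h z + g z) r = circle_integral h r + circle_integral g r.
Proof. exact: cintegralD mI. Qed.

Lemma circle_integrable_sum (I : Type) (s : seq I) (F : I -> R[i] -> R[i]) r :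
  (forall i, circle_integrable (F i) r) ->
  circle_integrable (fun z => \sum_(i <- s) F i z) r.
Proof. exact: cintegrable_sum mI. Qed.

Lemma circle_integral_sum (I : Type) (s : seq I) (F : I -> R[i] -> R[i]) r :
  (forall i, circle_integrable (F i) r) ->
  circle_integral (fun z => \sum_(i <- s) F i z) r =
  \sum_(i <- s) circle_integral (F i) r.
Proof. exact: cintegral_sum mI. Qed.

Lemma cabs_circle_integral_le h r (M : R) : circle_integrable h r ->
  (forall z, cabs z = `|r| -> cabs (h z) <= M) ->
  cabs (circle_integral h r) <= 2 * (M * (pi *+ 2)).
Proof.
move=> ih hM.
have iM : mu.-integrable `[0, pi *+ 2] (EFin \o (fun=> M)).
  by apply: continuous_compact_integrable;
    [exact: segment_compact|move=> x; exact: cvg_cst].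
have hMt t : `[0, pi *+ 2]%classic t -> cabs (h (circle_point r t)) <= M.
  by move=> _; apply: hM; exact: cabs_circle_point.
apply: le_trans (cabs_cintegral_le mI ih iM hMt) _.
rewrite Rintegral_cst//= lebesgue_measure_itv/= lte_fin.
by rewrite mulrn_wgt0 ?pi_gt0//= subr0.
Qed.

Lemma cderivableM f g z : cderivable f z -> cderivable g z ->
  cderivable (fun v => f v * g v) z.
Proof. by move=> df dg; exact: (@derivableM R[i] R[i]^o f g z 1 df dg). Qed.

Lemma cderivableB f g z : cderivable f z -> cderivable g z ->
  cderivable (fun v => f v - g v) z.
Proof.
by move=> df dg; exact: (@derivableB R[i] R[i]^o R[i]^o f g z 1 df dg).
Qed.

Lemma cderivable_cst c z : cderivable (fun=> c) z.
Proof. exact: derivable_cst. Qed.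

Lemma cderivable_id z : cderivable (fun v => v) z.
Proof. exact: derivable_id. Qed.

Lemma cderivableV f z : f z != 0 -> cderivable f z ->
  cderivable (fun v => (f v)^-1) z.
Proof. by move=> f0 df; exact: (@derivableV R[i] R[i]^o f z 1 f0 df). Qed.

Lemma cderivableX f z n : cderivable f z -> cderivable (fun v => f v ^+ n) z.
Proof.
move=> df; elim: n => [|n IH].
  by under eq_fun do rewrite expr0; exact: cderivable_cst.
by under eq_fun do rewrite exprS; exact: cderivableM.
Qed.

Lemma half_exp_neq1 n : (0 < n)%N -> (2^-1)%:C%C ^+ n != 1 :> R[i].
Proof.
move=> n0; apply/eqP => /(congr1 (@cabs R)).
rewrite cabs1 cabsX cabsC ger0_norm ?invr_ge0 ?ler0n; last exact: isT.
move=> h; have : (2^-1 : R) ^+ n < 1.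
  by rewrite exprn_ilt1 ?invr_ge0 ?ler0n ?invf_lt1 ?ltr1n -?lt0n.
by rewrite h ltxx.
Qed.

(** Doubling the radius multiplies the integral by 2^-n, yet the integral does not depend on the
    radius; hence it is 0. *)
Lemma circle_integral_inv_exp r n : 0 < r -> (0 < n)%N ->
  circle_integral (fun z => z^-1 ^+ n) r = 0.
Proof.
move=> r0 n0; set I := circle_integral _ _.
have dX z : z != 0 -> cderivable (fun z => z^-1 ^+ n) z.
  by move=> z0; apply/cderivableX/cderivableV => //; exact: cderivable_id.
have I2 : I = circle_integral (fun z => z^-1 ^+ n) (2 * r).
  apply: (@circle_integral_const _ _ 0 (3 * r)) => //; try lra.
  by move=> z z0 _; apply/cderivable_ex/dX; rewrite -cabs_gt0.
have : circle_integral (fun z => z^-1 ^+ n) (2 * r) = (2^-1)%:C%C ^+ n * I.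
  rewrite -circle_integralZ; last first.
    apply: cderivable_circle_integrable => z zr; apply: dX.
    by rewrite -cabs_gt0 zr gtr0_norm.
  by apply: eq_cintegral => t _; rewrite circle_pointM invfM exprMn fmorphV.
rewrite -I2 => /eqP; rewrite -subr_eq0 -{1}(mul1r I) -mulrBl mulf_eq0 subr_eq0.
by rewrite eq_sym (negPf (half_exp_neq1 n0)) => /eqP.
Qed.

Lemma circle_integral1 r : circle_integral (fun=> 1) r = (pi *+ 2)%:C%C.
Proof.
by rewrite /circle_integral seg_integral_cst ?pi2_ge0// mul1r subr0.
Qed.

(** The finite geometric expansion of 1 / (1 - a / z), whose remainder is (a / z)^N times the
    quotient itself. [d] stands for f z - f a. *)
Lemma difference_quotient_geometric (z a d : R[i]) N : z != 0 -> z != a ->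
  z * d / (z - a) = \sum_(k < N) a ^+ k * (d * z^-1 ^+ k) +
    (a / z) ^+ N * (z * d / (z - a)).
Proof.
move=> z0 za; have za0 : z - a != 0 by rewrite subr_eq0.
set q := z * d / (z - a).
have qE : (1 - a / z) * q = d by rewrite /q; field; rewrite z0 za0.
have -> : \sum_(k < N) a ^+ k * (d * z^-1 ^+ k) = (\sum_(k < N) (a / z) ^+ k) * d.
  by rewrite mulr_suml; apply: eq_bigr => k _; rewrite exprMn; ring.
rewrite -{1}qE mulrA (_ : _ * (1 - a / z) = 1 - (a / z) ^+ N); first by ring.
by rewrite -opprB mulrN mulrC -subrX1 opprB.
Qed.

(** The vanishing circle integral of z (f z - f a) / (z - a) is expanded geometrically. The terms in
    f a leave 2 pi f a; the others form a Taylor polynomial with Cauchy's coefficients, and the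
    error is the geometric remainder, of order (rho / r)^N. *)
Lemma disc_poly_approx f (B rho e : R) :
  (forall z, cabs z < B -> cderivable f z) -> 0 <= rho -> rho < B -> 0 < e ->
  exists p : {poly R[i]}, forall a, cabs a <= rho -> cabs (f a - p.[a]) <= e.
Proof.
move=> df rho0 rhoB e0; pose r := (rho + B) / 2.
have rr : rho < r by rewrite /r; lra.
have rB : r < B by rewrite /r; lra.
have r0 : 0 < r by exact: le_lt_trans rr.
have [M hM] : exists M, forall z, cabs z <= r -> cabs (f z) <= M.
  apply: (@bounded_on_disc _ f r B) => //; first exact: ltW.
  by move=> z /df/cderivable_ex[c]; exact: has_cderiv_continuous.
have M0 : 0 <= M by rewrite (le_trans _ (hM 0 _)) ?cabs_ge0// cabs0 ltW.
have circ0 z : cabs z = `|r| -> z != 0 by rewrite -cabs_gt0 => ->; rewrite gtr0_norm.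
have dV z : cabs z = `|r| -> cderivable (fun v => v^-1) z.
  by move=> /circ0 z0; apply: cderivableV => //; exact: cderivable_id.
have dfr z : cabs z = `|r| -> cderivable f z.
  by move=> zr; apply: df; rewrite zr gtr0_norm.
(* [K] bounds the difference quotient [q] on the circle of radius [r], where |f z - f a| <= 2 M and
   |z - a| >= r - rho. *)
pose K := r * (2 * M) / (r - rho).
have K0 : 0 <= K.
  apply: divr_ge0; last by rewrite subr_ge0 ltW.
  by apply: mulr_ge0; [exact: ltW|exact: mulr_ge0].
(* [N] must be positive for the sum to contain the term k = 0, which produces f a. *)
have [N N0 hN] : exists2 N, (0 < N)%N & 2 * ((rho / r) ^+ N * K) <= e.
  have : (2 * ((rho / r) ^+ n * K)) @[n --> \oo] --> (0 : R).
    rewrite -(mulr0 2) -(mul0r K); apply: cvgM; first exact: cvg_cst.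
    apply: cvgM; last exact: cvg_cst.
    have q0 : 0 <= rho / r by apply: divr_ge0 => //; exact: ltW.
    by apply: cvg_expr; rewrite ger0_norm// ltr_pdivrMr// mul1r.
  move=> /cvgr_le /(_ _ e0) [n _ hn]; exists n.+1 => //; exact: (hn n.+1 (leqnSn n)).
have pi0 : (pi *+ 2)%:C%C != 0 :> R[i].
  by rewrite -cabs_gt0 cabsC normr_gt0 mulrn_eq0/= gt_eqF// pi_gt0.
pose F k := circle_integral (fun z => f z * z^-1 ^+ k) r.
exists (\poly_(k < N) (F k / (pi *+ 2)%:C%C)) => a arho.
have ar : cabs a < r by exact: le_lt_trans rr.
have za z : cabs z = `|r| -> z != a.
  move=> zr; apply: contraTneq ar => <-; rewrite zr gtr0_norm//.
  by rewrite ltxx.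
pose q z := z * (f z - f a) / (z - a).
have dq z : cabs z = `|r| -> cderivable q z.
  move=> zr; apply: cderivableM; last apply: cderivableV.
  - apply: cderivableM; first exact: cderivable_id.
    by apply: cderivableB; [exact: dfr|exact: cderivable_cst].
  - by rewrite subr_eq0 za.
  - by apply: cderivableB; [exact: cderivable_id|exact: cderivable_cst].
pose T k z := a ^+ k * (f z * z^-1 ^+ k) - (a ^+ k * f a) * z^-1 ^+ k.
have iT1 k : circle_integrable (fun z => f z * z^-1 ^+ k) r.
  apply: cderivable_circle_integrable => z zr.
  by apply: cderivableM; [exact: dfr|apply/cderivableX/dV].
have iT2 k : circle_integrable (fun z => z^-1 ^+ k) r.
  by apply: cderivable_circle_integrable => z zr; apply/cderivableX/dV.
have iT k : circle_integrable (T k) r.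
  by apply: circle_integrableB; apply: circle_integrableZ.
pose E z := (a / z) ^+ N * q z.
have iE : circle_integrable E r.
  apply: cderivable_circle_integrable => z zr; apply: cderivableM; last exact: dq.
  by apply/cderivableX/cderivableM; [exact: cderivable_cst|exact: dV].
have := circle_difference_quotient df ar rB.
have -> : circle_integral (fun z => z * (f z - f a) / (z - a)) r =
    \sum_(k < N) circle_integral (T k) r + circle_integral E r.
  rewrite -(@circle_integral_sum _ (index_enum 'I_N) (fun k => T k))//.
  rewrite -circle_integralD//; last first.
    exact: (@circle_integrable_sum _ (index_enum 'I_N) (fun k => T k)).
  apply: eq_circle_integral => z zr.
  rewrite (difference_quotient_geometric _ N (circ0 z zr) (za z zr)).
  by congr +%R; apply: eq_bigr => k _; rewrite /T; ring.
have TE k : circle_integral (T k) r =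
    a ^+ k * F k - (a ^+ k * f a) * circle_integral (fun z => z^-1 ^+ k) r.
  by rewrite circle_integralB ?circle_integralZ//; exact: circle_integrableZ.
rewrite (eq_bigr _ (fun (k : 'I_N) _ => TE k)) sumrB.
(* The mean of z^-k is 0 for k > 0, so only k = 0 survives. *)
have -> : \sum_(k < N) a ^+ k * f a * circle_integral (fun z => z^-1 ^+ k) r =
    f a * (pi *+ 2)%:C%C.
  case: {+}N N0 => // n _; rewrite big_ord_recl expr0 mul1r big1.
    by rewrite addr0; congr (_ * _); rewrite -(circle_integral1 r);
      apply: eq_cintegral => t _; rewrite expr0.
  by move=> k _; rewrite circle_integral_inv_exp ?mulr0.
move=> h0.
have fE : f a - (\poly_(k < N) (F k / (pi *+ 2)%:C%C)).[a] =
    circle_integral E r / (pi *+ 2)%:C%C.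
  have lin (S X Y : R[i]) : S - X + Y = 0 -> X - S = Y.
    move=> h; rewrite (_ : X - S = Y - (S - X + Y)); last by ring.
    by rewrite h subr0.
  apply: (mulIf pi0); rewrite divfK// mulrBl horner_poly mulr_suml.
  rewrite (eq_bigr (fun k : 'I_N => a ^+ k * F k)); first exact: lin.
  by move=> k _; rewrite mulrAC divfK// mulrC.
rewrite fE cabsM cabsV cabsC ger0_norm ?pi2_ge0// ler_pdivrMr; last first.
  by rewrite mulrn_wgt0// pi_gt0.
apply: le_trans (_ : 2 * (((rho / r) ^+ N * K) * (pi *+ 2)) <= _); last first.
  by rewrite mulrA ler_wpM2r ?pi2_ge0.
apply: cabs_circle_integral_le => // z; rewrite gtr0_norm// => zr.
have r1 : 0 <= r^-1 by rewrite invr_ge0 ltW.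
have ar0 : 0 <= cabs a * r^-1 by apply: mulr_ge0 => //; exact: cabs_ge0.
rewrite /E cabsM cabsX (cabsM a) cabsV zr.
apply: ler_pM; [exact: exprn_ge0|exact: cabs_ge0| |].
  by apply: lerXn2r; rewrite ?nnegrE//; [exact: mulr_ge0|exact: ler_wpM2r].
rewrite /q !cabsM cabsV zr /K.
have zrho : r - rho <= cabs (z - a).
  have := cabs_sub_le z a; rewrite zr => /(le_trans _); apply.
  by rewrite lerD2l lerN2.
have rrho : 0 < r - rho by rewrite subr_gt0.
apply: ler_pM; [|by rewrite invr_ge0 cabs_ge0| |].
- by apply: mulr_ge0; [exact: ltW|exact: cabs_ge0].
- apply: ler_wpM2l; first exact: ltW.
  rewrite (le_trans (le_cabsB _ _))// mulrDl mul1r lerD// hM//; first by rewrite zr.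
  exact: ltW.
- by rewrite lef_pV2 ?posrE// (lt_le_trans rrho).
Qed.

End CauchyFormula.

(** * Weighted integrals over the disc *)

Section StepPolynomials.
Variable R : realType.
Implicit Types (x y h : R) (n N K : nat).

Lemma bernoulli_ge n h : 0 <= h -> 1 + n%:R * h <= (1 + h) ^+ n.
Proof.
move=> h0; elim: n => [|n IH]; first by rewrite mul0r addr0 expr0.
rewrite exprS -natr1; apply: le_trans (ler_wpM2l _ IH); last by rewrite addr_ge0.
have : 0 <= n%:R * (h * h) by rewrite mulr_ge0// mulr_ge0.
by move=> ?; lra.
Qed.

Lemma bernoulli_sub n x : 0 <= x -> x <= 1 -> 1 - n%:R * x <= (1 - x) ^+ n.
Proof.
move=> x0 x1; elim: n => [|n IH]; first by rewrite mul0r subr0 expr0.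
rewrite exprS -natr1; apply: le_trans (ler_wpM2l _ IH); last by rewrite subr_ge0.
have : 0 <= n%:R * (x * x) by rewrite mulr_ge0// mulr_ge0.
by move=> ?; lra.
Qed.

(** Writing x = u^2 and 1 / u = 1 + h, Bernoulli's inequality gives n h u^n <= 1, hence n x^n <= u^n
    / h. *)
Lemma natmul_expr_cvg0 x : 0 <= x -> x < 1 ->
  (n%:R * x ^+ n) @[n --> \oo] --> (0 : R).
Proof.
rewrite le_eqVlt => /predU1P[<- _|x0 x1].
  have e0 n : n%:R * 0 ^+ n = 0 :> R.
    by case: n => [|n]; rewrite ?mul0r// exprS mul0r mulr0.
  under eq_fun do rewrite e0.
  exact: cvg_cst.
pose u := Num.sqrt x; have u0 : 0 < u by rewrite sqrtr_gt0.
have xu : x = u * u by rewrite -expr2 sqr_sqrtr// ltW.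
have u1 : u < 1 by rewrite -sqrtr1 ltr_sqrt.
pose h := u^-1 - 1.
have h0 : 0 < h by rewrite subr_gt0 invf_gt1.
have bd n : n%:R * x ^+ n <= h^-1 * u ^+ n.
  rewrite xu exprMn mulrA ler_wpM2r ?exprn_ge0 ?(ltW u0)//.
  rewrite -[leRHS]div1r ler_pdivlMr//.
  have := ler_wpM2r (exprn_ge0 n (ltW u0)) (bernoulli_ge n (ltW h0)).
  rewrite -exprMn (_ : (1 + h) * u = 1) ?expr1n; last first.
    by rewrite /h addrC subrK mulVf// gt_eqF.
  have : 0 <= u ^+ n by rewrite exprn_ge0// ltW.
  by move=> ? ?; lra.
apply: (@squeeze_cvgr _ _ _ _ (fun=> 0) (fun n => h^-1 * u ^+ n)).
- by near=> n; rewrite bd andbT mulr_ge0// exprn_ge0// ltW.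
- exact: cvg_cst.
- rewrite -(mulr0 h^-1); apply: cvgM; first exact: cvg_cst.
  by apply: cvg_expr; rewrite ger0_norm// ltW.
Unshelve. all: by end_near. Qed.

(* A polynomial in [y], tending to the indicator of [1 <= K * y] on [0, 1]; the
   factor [N] in the exponent settles the threshold [K * y = 1]. *)
Definition step_approx K N y := 1 - (1 - y ^+ N) ^+ (N * K ^ N).

Lemma step_approx_itv K N y : 0 <= y -> y <= 1 -> 0 <= step_approx K N y <= 1.
Proof.
move=> y0 y1; have p0 : 0 <= 1 - y ^+ N by rewrite subr_ge0 exprn_ile1.
rewrite /step_approx subr_ge0 lerBlDr lerDl exprn_ge0//.
by rewrite exprn_ile1//= lerBlDr lerDl exprn_ge0.
Qed.

(** Put x = y^N and M = N K^N, so that M x = N (K y)^N. If K y >= 1, then (1 - x)^M <= 1 / (1 + x)^M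
    <= 1 / (1 + M x) <= 1 / (N + 1), also at the threshold. If K y < 1, then 1 - (1 - x)^M <= M x,
    which tends to 0. *)
Lemma step_approx_cvg K y : (0 < K)%N -> 0 <= y -> y <= 1 ->
  step_approx K N y @[N --> \oo] --> ((1 <= K%:R * y)%R%:R : R).
Proof.
move=> K0 y0 y1.
have MyE N : (N * K ^ N)%:R * y ^+ N = N%:R * (K%:R * y) ^+ N.
  by rewrite natrM natrX -mulrA -exprMn.
have yN N : 0 <= y ^+ N <= 1 by rewrite exprn_ge0//= exprn_ile1.
have [Ky|Ky] := leP 1 (K%:R * y); rewrite /=.
  rewrite -[X in _ --> X]subr0; apply: cvgB; first exact: cvg_cst.
  apply: (@squeeze_cvgr _ _ _ _ (fun=> 0) (fun n => n.+1%:R^-1)).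
  - near=> N; have /andP[x0 x1] := yN N; set x := y ^+ N in x0 x1 *.
    rewrite exprn_ge0 ?subr_ge0//=.
    have s0 : 0 < N.+1%:R :> R by rewrite ltr0n.
    rewrite -[leRHS]div1r ler_pdivlMr//.
    set M := (N * K ^ N)%N.
    apply: (@le_trans _ _ ((1 - x) ^+ M * (1 + x) ^+ M)).
      rewrite ler_wpM2l ?exprn_ge0 ?subr_ge0//.
      apply: le_trans (bernoulli_ge _ x0); rewrite MyE -natr1 addrC lerD2l.
      by rewrite ler_peMr// exprn_ege1.
    rewrite -exprMn exprn_ile1//; first by rewrite mulr_ge0 ?subr_ge0// addr_ge0.
    have : 0 <= x * x by rewrite mulr_ge0.
    by move=> ?; lra.
  - exact: cvg_cst.
  - exact: cvg_harmonic.
apply: (@squeeze_cvgr _ _ _ _ (fun=> 0) (fun N => N%:R * (K%:R * y) ^+ N)).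
- near=> N; have /andP[x0 x1] := yN N.
  have /andP[-> _] /= := step_approx_itv K N y0 y1.
  have := bernoulli_sub (N * K ^ N) x0 x1; rewrite /step_approx MyE.
  by move=> ?; lra.
- exact: cvg_cst.
- by apply: natmul_expr_cvg0 => //; rewrite mulr_ge0.
Unshelve. all: by end_near. Qed.

End StepPolynomials.

(** * Measurability of complex-valued functions *)

Section ComplexMeasurability.
Context d (T : measurableType d) (R : realType) (D : set T).
Implicit Types (F G : T -> R[i]).

Lemma cmeasurable_cst (c : R[i]) : cmeasurable D (fun=> c).
Proof. by split; exact: measurable_cst. Qed.

Lemma cmeasurableD F G : cmeasurable D F -> cmeasurable D G ->
  cmeasurable D (fun x => F x + G x).
Proof.
move=> [FR FI] [GR GI]; split.
- by under eq_fun do rewrite ReD; exact: measurable_funD.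
- by under eq_fun do rewrite ImD; exact: measurable_funD.
Qed.

Lemma cmeasurableM F G : cmeasurable D F -> cmeasurable D G ->
  cmeasurable D (fun x => F x * G x).
Proof.
move=> [FR FI] [GR GI]; split.
- by under eq_fun do rewrite ReM; apply: measurable_funB; exact: measurable_funM.
- by under eq_fun do rewrite ImM; apply: measurable_funD; exact: measurable_funM.
Qed.

Lemma cmeasurableB F G : cmeasurable D F -> cmeasurable D G ->
  cmeasurable D (fun x => F x - G x).
Proof.
move=> [FR FI] [GR GI]; split.
- by under eq_fun do rewrite ReD ReN; exact: measurable_funB.
- by under eq_fun do rewrite ImD ImN; exact: measurable_funB.
Qed.

Lemma cmeasurableX F n : cmeasurable D F -> cmeasurable D (fun x => F x ^+ n).
Proof.
move=> mF; elim: n => [|n IH].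
  by under eq_fun do rewrite expr0; exact: cmeasurable_cst.
by under eq_fun do rewrite exprS; exact: cmeasurableM.
Qed.

Lemma cmeasurableJ F : cmeasurable D F -> cmeasurable D (fun x => (F x)^*%C).
Proof.
move=> [FR FI]; split.
- by under eq_fun do rewrite ReJ.
- by under eq_fun do rewrite ImJ; exact: measurable_funN.
Qed.

Lemma cmeasurableC (f : T -> R) : measurable_fun D f ->
  cmeasurable D (fun x => (f x)%:C%C).
Proof. by move=> mf; split => //; exact: measurable_cst. Qed.

Lemma cmeasurable_cabs2 F : cmeasurable D F -> measurable_fun D (fun x => cabs2 (F x)).
Proof.
by move=> [FR FI]; apply: measurable_funD; exact: measurable_funX.
Qed.

End ComplexMeasurability.

Lemma Rintegral_dominated_cvg d (T : measurableType d) (R : realType)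
    (mu : {measure set T -> \bar R}) (D : set T) (f_ : nat -> T -> R)
    (f g : T -> R) : measurable D ->
  (forall n, measurable_fun D (f_ n)) ->
  (forall x, D x -> f_ n x @[n --> \oo] --> f x) ->
  mu.-integrable D (EFin \o g) -> (forall n x, D x -> `|f_ n x| <= g x) ->
  Rintegral mu D (f_ n) @[n --> \oo] --> Rintegral mu D f.
Proof.
move=> mD mf ff ig fg.
have mF n : measurable_fun D (EFin \o f_ n) by exact/measurable_EFinP.
have fF x : D x -> (EFin \o f_ n) x @[n --> \oo] --> (EFin \o f) x.
  by move=> Dx; apply: cvg_EFin; [exact: nearW|exact: ff].
have bF n x : D x -> (`|(EFin \o f_ n) x| <= (EFin \o g) x)%E.
  by move=> Dx; rewrite /= lee_fin fg.
have mFf : measurable_fun D (EFin \o f) by exact: emeasurable_fun_cvg mF fF.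
have [iF _ cF] := dominated_convergence mD mF mFf
  (aeW mu fF) ig (aeW mu (fun x n => bF n x)).
apply: fine_cvg; rewrite fineK; first exact: cF.
exact: integrable_fin_num.
Qed.

(** * Integration against the radial weight *)

Section WeightedDisc.
Variables (R : realType) (Rad : R) (w : R -> R).
Local Notation T := (measurableTypeR R * measurableTypeR R)%type.
Local Notation mu := (@leb2 R).
Local Notation D := (disc2 Rad : set T).
Local Notation W := (weight w).
Implicit Types (f g F G : R[i] -> R[i]) (z : R[i]) (p : T).

Definition wmeasurable F := cmeasurable D (fun p => F (toC p)).

Definition wintegrable F :=
  cintegrable mu D (fun p => F (toC p) * (W p)%:C%C).

Definition wintegral F : R[i] :=
  cintegral mu D (fun p => F (toC p) * (W p)%:C%C).

Lemma cinnerE f g :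
  cinner Rad w f g = wintegral (fun z => f z * (g z)^*%C).
Proof.
apply: complexP; apply: eq_Rintegral => p _.
- by rewrite [RHS]ReM ImC mulr0 subr0.
- by rewrite [RHS]ImM ImC mulr0 add0r.
Qed.

Lemma L2_wmeasurable f : L2 Rad w f -> wmeasurable f.
Proof. by case=> mR [mI _]; split. Qed.

Lemma measurable_toC_cabs2 (A : set T) :
  measurable_fun A (fun p => cabs2 (toC p)).
Proof.
apply: measurable_funTS; apply: measurable_funD; apply: measurable_funX.
  exact: measurable_fst.
exact: measurable_snd.
Qed.

Lemma measurable_disc2 : measurable D.
Proof.
have mS : measurable (`]-oo, Rad ^+ 2[ : set R) by exact: measurable_itv.
have := measurable_toC_cabs2 (A := setT) measurableT mS.
by rewrite setTI; congr measurable; apply/seteqP; split => p; rewrite /= in_itv.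
Qed.

Let mD := measurable_disc2.

Lemma wmeasurable_id : wmeasurable (fun z => z).
Proof.
by split; apply: measurable_funTS; [exact: measurable_fst|exact: measurable_snd].
Qed.

Hypothesis hRad : 0 < Rad.
Hypothesis hw_meas : measurable_fun `[0, Rad[ w.
Hypothesis hw_ge0 : forall r, 0 <= r -> r < Rad -> 0 <= w r.

Lemma discP p : D p <-> cabs (toC p) < Rad.
Proof. by rewrite /disc2 /= lt_cabs2// ltW. Qed.

Lemma weight_ge0 p : D p -> 0 <= W p.
Proof. by move=> /discP; rewrite cabsE => h; rewrite hw_ge0// sqrtr_ge0. Qed.

Lemma measurable_weight : measurable_fun D W.
Proof.
have mI : measurable (`[0, Rad[ : set R) by exact: measurable_itv.
have sub : (fun p : T => Num.sqrt (cabs2 (toC p))) @` D `<=` `[0, Rad[.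
  move=> _ [p /discP pD <-] /=; rewrite in_itv/= sqrtr_ge0/=.
  by rewrite cabsE in pD.
have mg : measurable_fun D (fun p : T => Num.sqrt (cabs2 (toC p))).
  apply: (@measurableT_comp _ _ _ _ _ _ (@Num.sqrt R)).
    by apply: continuous_measurable_fun; exact: sqrt_continuous.
  exact: measurable_toC_cabs2.
exact: (measurable_comp mI sub hw_meas mg).
Qed.

Hypothesis iW : mu.-integrable D (EFin \o W).

Lemma wmeasurable_weighted F : wmeasurable F ->
  cmeasurable D (fun p => F (toC p) * (W p)%:C%C).
Proof.
by move=> mF; apply: cmeasurableM => //; apply: cmeasurableC; exact: measurable_weight.
Qed.

Lemma cabs_weighted F p : D p ->
  cabs (F (toC p) * (W p)%:C%C) = cabs (F (toC p)) * W p.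
Proof. by move=> Dp; rewrite cabsM cabsC ger0_norm// weight_ge0. Qed.

Lemma eq_wintegral F G : (forall z, cabs z < Rad -> F z = G z) ->
  wintegral F = wintegral G.
Proof.
by move=> FG; apply: eq_cintegral => p; rewrite inE => /discP pD; rewrite FG.
Qed.

Lemma wintegralD F G : wintegrable F -> wintegrable G ->
  wintegral (fun z => F z + G z) = wintegral F + wintegral G.
Proof.
move=> iF iG; rewrite /wintegral -(cintegralD mD iF iG).
by apply: eq_cintegral => p _; rewrite mulrDl.
Qed.

Lemma wintegralB F G : wintegrable F -> wintegrable G ->
  wintegral (fun z => F z - G z) = wintegral F - wintegral G.
Proof.
move=> iF iG; rewrite /wintegral -(cintegralB mD iF iG).
by apply: eq_cintegral => p _; rewrite mulrBl.
Qed.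

Lemma wintegrableZ (c : R[i]) F : wintegrable F -> wintegrable (fun z => c * F z).
Proof.
move=> iF; apply: eq_cintegrable (cintegrableZ c mD iF) => // p _.
by rewrite mulrA.
Qed.

Lemma wintegralZ (c : R[i]) F : wintegrable F ->
  wintegral (fun z => c * F z) = c * wintegral F.
Proof.
move=> iF; rewrite /wintegral -(cintegralZ c mD iF).
by apply: eq_cintegral => p _; rewrite mulrA.
Qed.

Lemma wintegral_sum (I : Type) (s : seq I) (F : I -> R[i] -> R[i]) :
  (forall i, wintegrable (F i)) ->
  wintegral (fun z => \sum_(i <- s) F i z) = \sum_(i <- s) wintegral (F i).
Proof.
move=> iF; rewrite /wintegral -(cintegral_sum s mD iF).
by apply: eq_cintegral => p _; rewrite mulr_suml.
Qed.

Lemma wintegralJ F : wintegrable F ->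
  wintegral (fun z => (F z)^*%C) = ((wintegral F)^*)%C.
Proof.
move=> [_ iI]; apply: complexP; rewrite ?ReJ ?ImJ.
  by apply: eq_Rintegral => p _; rewrite !ReM ReJ ImC !mulr0.
rewrite -mulN1r /= -(RintegralZl (-1) mD iI).
by apply: eq_Rintegral => p _; rewrite !ImM ImJ ImC !mulr0 !add0r mulN1r mulNr.
Qed.

Lemma integrable_weightZ (M : R) : mu.-integrable D (EFin \o (fun p => M * W p)).
Proof. by apply: eq_integrable (integrableZl mD M iW). Qed.

Lemma wintegrable_bounded F (M : R) : wmeasurable F ->
  (forall z, cabs z < Rad -> cabs (F z) <= M) -> wintegrable F.
Proof.
move=> mF FM.
apply: (le_cintegrable mD (wmeasurable_weighted mF) (integrable_weightZ M)) => p Dp.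
rewrite cabs_weighted// ler_wpM2r ?weight_ge0//.
by apply: FM; exact/discP.
Qed.

Lemma cabs_wintegral_le F (M : R) : wmeasurable F ->
  (forall z, cabs z < Rad -> cabs (F z) <= M) ->
  cabs (wintegral F) <= 2 * (M * Rintegral mu D W).
Proof.
move=> mF FM; rewrite -(RintegralZl M mD iW).
apply: (cabs_cintegral_le mD (wintegrable_bounded mF FM) (integrable_weightZ M)) => p Dp.
rewrite cabs_weighted// ler_wpM2r ?weight_ge0//.
by apply: FM; exact/discP.
Qed.

Lemma L2_sq_integrable f : L2 Rad w f ->
  mu.-integrable D (EFin \o (fun p => cabs2 (f (toC p)) * W p)).
Proof.
move=> fL2; have mf := L2_wmeasurable fL2; case: fL2 => _ [_ nf].
apply/integrableP; split.
  apply/measurable_EFinP; apply: measurable_funM; last exact: measurable_weight.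
  exact: cmeasurable_cabs2.
rewrite (eq_integral (fun p => (cabs2 (f (toC p)) * W p)%:E))// => p.
rewrite inE => Dp /=; rewrite ger0_norm// mulr_ge0 ?cabs2_ge0//.
exact: weight_ge0.
Qed.

(** Since |f| <= 1 + |f|^2, this dominates |f G| W whenever |G| <= M, and it is integrable because
    dmu has finite mass. *)
Definition L2_majorant (M : R) f p := M * (W p + cabs2 (f (toC p)) * W p).

Lemma L2_majorant_integrable M f : L2 Rad w f ->
  mu.-integrable D (EFin \o L2_majorant M f).
Proof.
move=> /L2_sq_integrable fi.
exact: eq_integrable (integrableZl mD M (integrableD mD iW fi)).
Qed.

Lemma le_L2_majorant M f G p : D p -> cabs (G (toC p)) <= M ->
  cabs (f (toC p) * G (toC p) * (W p)%:C%C) <= L2_majorant M f p.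
Proof.
move=> Dp GM; rewrite (cabs_weighted (fun z => f z * G z))// cabsM /L2_majorant.
rewrite -[X in M * (X + _)]mul1r -mulrDl mulrA ler_wpM2r ?weight_ge0//.
rewrite mulrC ler_pM ?cabs_ge0// -sqr_cabs.
have := sqr_ge0 (cabs (f (toC p)) - 1); have := cabs_ge0 (f (toC p)).
by nra.
Qed.

Lemma wintegrable_L2 f G (M : R) : L2 Rad w f -> wmeasurable G ->
  (forall z, cabs z < Rad -> cabs (G z) <= M) ->
  wintegrable (fun z => f z * G z).
Proof.
move=> fL2 mG GM; have mf := L2_wmeasurable fL2.
apply: (le_cintegrable mD _ (L2_majorant_integrable M fL2)).
  by apply: (wmeasurable_weighted (F := fun z => f z * G z)); exact: cmeasurableM.
by move=> p Dp; apply: le_L2_majorant => //; apply: GM; exact/discP.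
Qed.

(** Serves both limit passages: from polynomials in |z|^2 to a cutoff, and from cutoffs to the whole
    disc. *)
Lemma wintegral_limit0 (F_ : nat -> R[i] -> R[i]) F (g : T -> R) :
  (forall n, wmeasurable (F_ n)) -> mu.-integrable D (EFin \o g) ->
  (forall n p, D p -> cabs (F_ n (toC p) * (W p)%:C%C) <= g p) ->
  (forall z, cabs z < Rad ->
    complex.Re (F_ n z) @[n --> \oo] --> complex.Re (F z) /\
    complex.Im (F_ n z) @[n --> \oo] --> complex.Im (F z)) ->
  (forall n, wintegral (F_ n) = 0) -> wintegral F = 0.
Proof.
move=> mF ig Fg FF F0.
have mFW n := wmeasurable_weighted (mF n).
have cR : Rintegral mu D (fun p => complex.Re (F_ n (toC p) * (W p)%:C%C)) @[n --> \oo]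
    --> Rintegral mu D (fun p => complex.Re (F (toC p) * (W p)%:C%C)).
  apply: Rintegral_dominated_cvg ig _ => //.
  - by move=> n; have [] := mFW n.
  - move=> p /discP/FF[h _]; rewrite ReM ImC mulr0 subr0.
    under eq_fun do rewrite ReM ImC mulr0 subr0.
    by apply: cvgM => //; exact: cvg_cst.
  - by move=> n p Dp; rewrite (le_trans (norm_Re_le _))// Fg.
have cI : Rintegral mu D (fun p => complex.Im (F_ n (toC p) * (W p)%:C%C)) @[n --> \oo]
    --> Rintegral mu D (fun p => complex.Im (F (toC p) * (W p)%:C%C)).
  apply: Rintegral_dominated_cvg ig _ => //.
  - by move=> n; have [] := mFW n.
  - move=> p /discP/FF[_ h]; rewrite ImM ImC mulr0 add0r.
    under eq_fun do rewrite ImM ImC mulr0 add0r.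
    by apply: cvgM => //; exact: cvg_cst.
  - by move=> n p Dp; rewrite (le_trans (norm_Im_le _))// Fg.
have zR n : Rintegral mu D (fun p => complex.Re (F_ n (toC p) * (W p)%:C%C)) = 0.
  exact: (congr1 (@complex.Re R) (F0 n)).
have zI n : Rintegral mu D (fun p => complex.Im (F_ n (toC p) * (W p)%:C%C)) = 0.
  exact: (congr1 (@complex.Im R) (F0 n)).
move: cR cI; rewrite (funext zR) (funext zI) => cR cI; apply: complexP.
  exact: (cvg_unique _ cR (cvg_cst _)).
exact: (cvg_unique _ cI (cvg_cst _)).
Qed.

Lemma wintegrable_sum (I : Type) (s : seq I) (F : I -> R[i] -> R[i]) :
  (forall i, wintegrable (F i)) ->
  wintegrable (fun z => \sum_(i <- s) F i z).
Proof.
move=> iF; apply: eq_cintegrable (cintegrable_sum s mD iF) => // p _.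
by rewrite mulr_suml.
Qed.

Lemma wmeasurableJ F : wmeasurable F -> wmeasurable (fun z => (F z)^*%C).
Proof. exact: cmeasurableJ. Qed.

Lemma wmeasurableM F G : wmeasurable F -> wmeasurable G ->
  wmeasurable (fun z => F z * G z).
Proof. exact: cmeasurableM. Qed.

Lemma wmeasurableX F n : wmeasurable F -> wmeasurable (fun z => F z ^+ n).
Proof. exact: cmeasurableX. Qed.

Lemma wmeasurableB F G : wmeasurable F -> wmeasurable G ->
  wmeasurable (fun z => F z - G z).
Proof. exact: cmeasurableB. Qed.

Lemma wmeasurable_cst (c : R[i]) : wmeasurable (fun=> c).
Proof. exact: cmeasurable_cst. Qed.

Lemma wmeasurable_horner (q : {poly R[i]}) : wmeasurable (fun z => q.[z]).
Proof.
elim/poly_ind: q => [|q c IH].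
  by under eq_fun do rewrite horner0; exact: wmeasurable_cst.
under eq_fun do rewrite hornerMXaddC.
exact: (cmeasurableD (wmeasurableM IH wmeasurable_id) (wmeasurable_cst c)).
Qed.

(** * Orthogonality of monomials on smaller discs *)

Definition bimonomial i j z : R[i] := z ^+ i * (z^*)%C ^+ j.

Lemma wmeasurable_bimonomial i j : wmeasurable (bimonomial i j).
Proof.
exact: (wmeasurableM (wmeasurableX i wmeasurable_id)
  (wmeasurableX j (wmeasurableJ wmeasurable_id))).
Qed.

Lemma cabs_bimonomial_le i j z : cabs z < Rad -> cabs (bimonomial i j z) <= Rad ^+ (i + j).
Proof.
move=> /ltW zR; rewrite cabsM !cabsX cabsJ -exprD.
by apply: lerXn2r; rewrite ?nnegrE ?cabs_ge0// ltW.
Qed.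

Lemma wintegrable_bimonomial i j : wintegrable (bimonomial i j).
Proof.
apply: wintegrable_bounded (@cabs_bimonomial_le i j).
exact: wmeasurable_bimonomial.
Qed.

Lemma bimonomial_cabs2X i j l z :
  bimonomial i j z * ((cabs2 z) ^+ l)%:C%C = bimonomial (i + l) (j + l) z.
Proof.
by rewrite rmorphXn /= -mulcJ /bimonomial exprMn !exprD; ring.
Qed.

Hypothesis horth : forall i j, i != j ->
  cinner Rad w (@monomial R i) (@monomial R j) = 0.

Lemma bimonomial_orth i j : i != j -> wintegral (bimonomial i j) = 0.
Proof.
move=> /horth; rewrite cinnerE => <-; apply: eq_wintegral => z _.
by rewrite /bimonomial /monomial rmorphXn.
Qed.

(** Each power |z|^(2l) shifts both exponents by l, so i + l and j + l stay distinct and every term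
    vanishes. *)
Lemma bimonomial_poly_orth i j (Q : {poly R}) : i != j ->
  wintegral (fun z => bimonomial i j z * (Q.[cabs2 z])%:C%C) = 0.
Proof.
move=> ij; pose F (l : 'I_(size Q)) z := (Q`_l)%:C%C * bimonomial (i + l) (j + l) z.
rewrite (eq_wintegral (G := fun z => \sum_l F l z)); last first.
  move=> z _; rewrite horner_coef rmorph_sum mulr_sumr; apply: eq_bigr => l _.
  by rewrite rmorphM mulrCA bimonomial_cabs2X.
rewrite wintegral_sum; last by move=> l; apply: wintegrableZ; exact: wintegrable_bimonomial.
rewrite big1// => l _; rewrite wintegralZ; last exact: wintegrable_bimonomial.
by rewrite bimonomial_orth ?mulr0// eqn_add2r.
Qed.

(** A polynomial in |z|^2 that decreases with |z| and takes values in ]0, 1] on the disc. Step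
    polynomials select large arguments, hence small radii. *)
Definition radius_defect z : R := 1 - cabs2 z / Rad ^+ 2.

Lemma radius_defect_itv z : cabs z < Rad -> 0 < radius_defect z <= 1.
Proof.
move=> zR; have R2 : 0 < Rad ^+ 2 by rewrite exprn_gt0.
rewrite /radius_defect subr_gt0 ltr_pdivrMr// mul1r lt_cabs2 ?(ltW hRad)// zR/=.
by rewrite lerBlDr lerDl divr_ge0 ?cabs2_ge0// ltW.
Qed.

Lemma measurable_radius_defect : measurable_fun D (fun p => radius_defect (toC p)).
Proof.
apply: measurable_funB; first exact: measurable_cst.
by apply: measurable_funM; [exact: measurable_toC_cabs2|exact: measurable_cst].
Qed.

Lemma measurable_step_approx K N :
  measurable_fun D (fun p => step_approx K N (radius_defect (toC p))).
Proof.
apply: measurable_funB; first exact: measurable_cst.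
apply/measurable_funX/measurable_funB; first exact: measurable_cst.
by apply: measurable_funX; exact: measurable_radius_defect.
Qed.

(* The indicator of the disc [cabs2 z <= Rad ^+ 2 * (1 - 1 / (k + 2))]. *)
Definition cutoff (k : nat) z : R := (1 <= k.+2%:R * radius_defect z)%R%:R.

Lemma cutoff_itv k z : 0 <= cutoff k z <= 1.
Proof. by rewrite ler0n lern1 leq_b1. Qed.

Lemma step_approx_cutoff k z : cabs z < Rad ->
  step_approx k.+2 N (radius_defect z) @[N --> \oo] --> cutoff k z.
Proof.
by move=> /radius_defect_itv/andP[y0 y1]; apply: step_approx_cvg => //; exact: ltW.
Qed.

Lemma measurable_cutoff k : measurable_fun D (fun p => cutoff k (toC p)).
Proof.
apply: (measurable_fun_cvg (h := fun N p => step_approx k.+2 N (radius_defect (toC p)))).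
  by move=> N; exact: measurable_step_approx.
by move=> p /discP; exact: step_approx_cutoff.
Qed.

Lemma wmeasurable_cutoff k : wmeasurable (fun z => (cutoff k z)%:C%C).
Proof. by apply: cmeasurableC; exact: measurable_cutoff. Qed.

Lemma cutoff_orth k i j : i != j ->
  wintegral (fun z => bimonomial i j z * (cutoff k z)%:C%C) = 0.
Proof.
move=> ij.
pose s N z := step_approx k.+2 N (radius_defect z).
apply: (@wintegral_limit0 (fun N z => bimonomial i j z * (s N z)%:C%C) _
  (fun p => Rad ^+ (i + j) * W p)).
- move=> N; apply: wmeasurableM; first exact: wmeasurable_bimonomial.
  by apply: cmeasurableC; exact: measurable_step_approx.
- exact: integrable_weightZ.
- move=> N p Dp; have /discP pR := Dp.
  have /andP[y0 y1] := radius_defect_itv pR.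
  have /andP[s0 s1] := step_approx_itv k.+2 N (ltW y0) y1.
  rewrite (cabs_weighted (fun z => bimonomial i j z * (s N z)%:C%C))//.
  rewrite ler_wpM2r ?weight_ge0// cabsM cabsC ger0_norm//.
  by rewrite -[leRHS]mulr1 ler_pM ?cabs_ge0// cabs_bimonomial_le.
- move=> z zR; have sc := step_approx_cutoff (k := k) zR.
  rewrite (ReM (bimonomial i j z)) (ImM (bimonomial i j z)) !ReC !ImC.
  rewrite !mulr0 subr0 add0r; split.
    under eq_fun do rewrite (ReM (bimonomial i j z)) ReC ImC mulr0 subr0.
    exact: (cvgM (cvg_cst _) sc).
  under eq_fun do rewrite (ImM (bimonomial i j z)) ReC ImC mulr0 add0r.
  exact: (cvgM (cvg_cst _) sc).
(* [Y] is the radius defect as a polynomial in |z|^2; composed with the step polynomial it is still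
   a polynomial in |z|^2. *)
- move=> N; pose Y : {poly R} := 1 - (Rad ^- 2)%:P * 'X.
  have := bimonomial_poly_orth (1 - (1 - Y ^+ N) ^+ (N * k.+2 ^ N)) ij.
  move=> <-; apply: eq_wintegral => z _; congr (_ * _%:C%C).
  rewrite /s /step_approx /radius_defect hornerD hornerN hornerC horner_exp.
  rewrite hornerD hornerN hornerC horner_exp hornerD hornerN hornerC hornerCM hornerX.
  by rewrite (mulrC (Rad ^- 2)).
Qed.

Definition cutoff_radius k : R := Rad * Num.sqrt (1 - k.+2%:R^-1).

Lemma cutoff_radius_itv k : 0 <= cutoff_radius k < Rad.
Proof.
by rewrite mulr_ge0 ?sqrtr_ge0 ?(ltW hRad)//= gtr_pMr// -[ltRHS]sqrtr1 ltr_sqrt//.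
Qed.

Lemma cutoff_support k z : cutoff_radius k < cabs z -> cutoff k z = 0.
Proof.
move=> kz; rewrite /cutoff; case: leP => // h; exfalso; move: kz; apply/negP.
have k1 : 0 <= 1 - k.+2%:R^-1 :> R by rewrite subr_ge0 invf_le1// ler1n.
have R2 : 0 < Rad ^+ 2 by rewrite exprn_gt0.
have /andP[r0 _] := cutoff_radius_itv k.
rewrite -leNgt -(ler_pXn2r (n := 2))// ?nnegrE ?cabs_ge0// sqr_cabs exprMn sqr_sqrtr//.
rewrite mulrC -ler_pdivrMr// lerBrDr -lerBrDl -/(radius_defect z).
by rewrite -[leLHS]div1r ler_pdivrMr// mulrC.
Qed.

Lemma cutoff_cvg z : cabs z < Rad -> cutoff k z @[k --> \oo] --> (1 : R).
Proof.
move=> /radius_defect_itv/andP[y0 y1].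
apply: cvg_near_cst; near=> k; rewrite /cutoff.
have -> : (1 <= k.+2%:R * radius_defect z)%R => //.
rewrite -ler_pdivrMr// div1r.
have : (radius_defect z)^-1 <= k%:R by near: k; exact: nbhs_infty_ger.
by move=> /le_trans; apply; rewrite ler_nat (leq_trans (leqnSn k)).
Unshelve. all: by end_near. Qed.

Lemma le_epsilon_mul0 (x C : R) : 0 <= C -> (forall e, 0 < e -> x <= e * C) -> x <= 0.
Proof.
move=> C0 h; apply/ler_addgt0Pr => e e0; rewrite add0r.
have k0 : 0 < 1 + C by rewrite ltr_pwDl.
apply: le_trans (h (e / (1 + C)) _) _; first by rewrite divr_gt0.
by rewrite -mulrA ler_piMr ?(ltW e0)// mulrC ler_pdivrMr// mul1r lerDr.
Qed.

(* The kernel lives on a compact subdisc, where [f] is a uniform limit of polynomials. *)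
Lemma wintegral_kernel_eq0 f F (rho M : R) : wmeasurable f ->
  (forall z, cabs z < Rad -> cderivable f z) -> 0 <= rho -> rho < Rad ->
  wmeasurable F -> (forall z, cabs z < Rad -> cabs (F z) <= M) ->
  (forall z, rho < cabs z -> F z = 0) ->
  (forall j, wintegral (fun z => z ^+ j * F z) = 0) ->
  wintegral (fun z => f z * F z) = 0.
Proof.
move=> mf df rho0 rhoR mF FM F0 Fj.
have M0 : 0 <= M by rewrite (le_trans _ (FM 0 _)) ?cabs_ge0// cabs0.
have I0 : 0 <= Rintegral mu D W by apply: Rintegral_ge0; exact: weight_ge0.
apply/eqP; rewrite -cabs_eq0 eq_le cabs_ge0 andbT.
apply: (@le_epsilon_mul0 _ (2 * (M * Rintegral mu D W))); first by rewrite !mulr_ge0.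
move=> e e0; have [q hq] := disc_poly_approx df rho0 rhoR e0.
have mq : wmeasurable (fun z => (f z - q.[z]) * F z).
  by apply: wmeasurableM => //; apply: wmeasurableB => //; exact: wmeasurable_horner.
have bq z : cabs z < Rad -> cabs ((f z - q.[z]) * F z) <= e * M.
  move=> zR; have [zrho|zrho] := leP (cabs z) rho.
    by rewrite cabsM ler_pM ?cabs_ge0 ?hq// FM.
  by rewrite F0// mulr0 cabs0 mulr_ge0// ltW.
have ij j : wintegrable (fun z => z ^+ j * F z).
  apply: (@wintegrable_bounded _ (Rad ^+ j * M)).
    by apply: wmeasurableM => //; apply: wmeasurableX; exact: wmeasurable_id.
  move=> z zR; rewrite cabsM cabsX ler_pM ?exprn_ge0 ?cabs_ge0 ?FM//.
  by apply: lerXn2r; rewrite ?nnegrE ?cabs_ge0// ltW.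
pose P (l : 'I_(size q)) z := q`_l * (z ^+ l * F z).
(* The polynomial part integrates to 0 by [Fj]. Beyond [rho] the kernel vanishes, so the
   approximation on the small disc bounds the rest everywhere. *)
have -> : wintegral (fun z => f z * F z) =
    wintegral (fun z => (f z - q.[z]) * F z) + wintegral (fun z => \sum_l P l z).
  rewrite -wintegralD; first apply: eq_wintegral => z _.
  - rewrite mulrBl horner_coef mulr_suml.
    by rewrite (eq_bigr (fun l : 'I_(size q) => P l z)) ?subrK// => l _; rewrite /P mulrA.
  - exact: wintegrable_bounded bq.
  - by apply: wintegrable_sum => l; exact: wintegrableZ.
rewrite wintegral_sum; last by move=> l; exact: wintegrableZ.
rewrite big1 ?addr0; last by move=> l _; rewrite wintegralZ// Fj mulr0.
apply: le_trans (cabs_wintegral_le mq bq) _.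
by rewrite le_eqVlt; apply/orP; left; apply/eqP; ring.
Qed.
Definition cutoff_moment k m : R :=
  Rintegral mu D (fun p => cabs2 (toC p) ^+ m * cutoff k (toC p) * W p).

Lemma measurable_moment k m :
  measurable_fun D (fun p => cabs2 (toC p) ^+ m * cutoff k (toC p) * W p).
Proof.
apply: measurable_funM; last exact: measurable_weight.
apply: measurable_funM; last exact: measurable_cutoff.
by apply: measurable_funX; exact: measurable_toC_cabs2.
Qed.

Lemma cabs2X_le m z : cabs z < Rad -> cabs2 z ^+ m <= (Rad ^+ 2) ^+ m.
Proof.
move=> zR; apply: lerXn2r; rewrite ?nnegrE ?cabs2_ge0 ?exprn_ge0 ?(ltW hRad)//.
by rewrite ltW// lt_cabs2// ltW.
Qed.

Lemma moment_le k m p : D p ->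
  `|cabs2 (toC p) ^+ m * cutoff k (toC p) * W p| <= (Rad ^+ 2) ^+ m * W p.
Proof.
move=> Dp; have /andP[c0 c1] := cutoff_itv k (toC p); have W0 := weight_ge0 Dp.
have x0 : 0 <= cabs2 (toC p) ^+ m by rewrite exprn_ge0 ?cabs2_ge0.
rewrite ger0_norm ?mulr_ge0// ler_wpM2r// -[leRHS]mulr1 ler_pM//.
by apply: cabs2X_le; exact/discP.
Qed.

Lemma cutoff_moment_cvg m : cutoff_moment k m @[k --> \oo] --> cn2 Rad w m.
Proof.
have -> : cn2 Rad w m = Rintegral mu D (fun p => cabs2 (toC p) ^+ m * W p).
  rewrite /cn2 /nrm2 /Rintegral; congr fine.
  by apply: eq_integral => p _; rewrite /monomial cabs2X.
apply: Rintegral_dominated_cvg (integrable_weightZ ((Rad ^+ 2) ^+ m)) _ => //.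
- by move=> k; exact: measurable_moment.
- move=> p /discP pR.
  have := cvgM (cvgM (cvg_cst (cabs2 (toC p) ^+ m)) (cutoff_cvg pR)) (cvg_cst (W p)).
  by rewrite mulr1 => h; exact: h.
- by move=> k p; exact: moment_le.
Qed.

Lemma cutoff_moment_itv k m :
  `|cutoff_moment k m| <= (Rad ^+ 2) ^+ m * Rintegral mu D W.
Proof.
have im : mu.-integrable D
    (EFin \o (fun p => cabs2 (toC p) ^+ m * cutoff k (toC p) * W p)).
  apply: le_integrable (integrable_weightZ ((Rad ^+ 2) ^+ m)) => //.
    by apply/measurable_EFinP; exact: measurable_moment.
  move=> p Dp /=; rewrite lee_fin [leRHS]ger0_norm ?moment_le//.
  by rewrite mulr_ge0 ?weight_ge0// !exprn_ge0// ltW.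
rewrite (le_trans (le_normr_Rintegral mD im))// -(RintegralZl _ mD iW).
apply: le_Rintegral => //.
- exact: integrable_norm.
- exact: integrable_weightZ.
- by move=> p; exact: moment_le.
Qed.

Lemma wintegral_cutoff_diag k m :
  wintegral (fun z => bimonomial m m z * (cutoff k z)%:C%C) = (cutoff_moment k m)%:C%C.
Proof.
have E p : bimonomial m m (toC p) * (cutoff k (toC p))%:C%C * (W p)%:C%C =
    (cabs2 (toC p) ^+ m * cutoff k (toC p) * W p)%:C%C.
  rewrite !rmorphM; congr (_ * _ * _).
  by rewrite -[X in bimonomial X]add0n -[X in bimonomial _ X]add0n
     -bimonomial_cabs2X /bimonomial !expr0 !mul1r.
apply: complexP; rewrite /wintegral /cintegral.
  by apply: eq_Rintegral => p _; rewrite E.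
rewrite [LHS](_ : _ = Rintegral mu D (fun=> 0)).
  by rewrite /Rintegral integral0.
by apply: eq_Rintegral => p _; rewrite E.
Qed.

Lemma wintegrable_bimonomial_cutoff k i j :
  wintegrable (fun z => bimonomial i j z * (cutoff k z)%:C%C).
Proof.
apply: (@wintegrable_bounded _ (Rad ^+ (i + j))).
  exact: (wmeasurableM (wmeasurable_bimonomial i j) (wmeasurable_cutoff k)).
move=> z zR; have /andP[c0 c1] := cutoff_itv k z.
by rewrite cabsM cabsC ger0_norm// -[leRHS]mulr1 ler_pM ?cabs_ge0// cabs_bimonomial_le.
Qed.

(** * Orthogonality to the whole of A^2 *)

Lemma bergman_cderivable f : bergman Rad w f ->
  forall z, cabs z < Rad -> cderivable f z.
Proof.
by move=> [hf _] z zR; apply: hf; rewrite /discC /= lt_cabs2// ltW.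
Qed.

(** The case n = 0, where conj(u_0) is a multiple of z. On a smaller disc z^j z has exponents j + 1
    and 0, which always differ. *)
Lemma bergman_zmul_orth f : bergman Rad w f -> wintegral (fun z => f z * z) = 0.
Proof.
move=> bf; have df := bergman_cderivable bf; have [_ fL2] := bf.
have mf := L2_wmeasurable fL2.
pose F k z := bimonomial 1 0 z * (cutoff k z)%:C%C.
have mF k : wmeasurable (F k).
  exact: (wmeasurableM (wmeasurable_bimonomial 1 0) (wmeasurable_cutoff k)).
have bF k z : cabs z < Rad -> cabs (F k z) <= Rad.
  move=> zR; have /andP[c0 c1] := cutoff_itv k z.
  rewrite cabsM cabsC ger0_norm// -[leRHS]mulr1 ler_pM ?cabs_ge0//.
  by rewrite (le_trans (cabs_bimonomial_le 1 0 zR)).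
have F0 k : wintegral (fun z => f z * F k z) = 0.
  have /andP[r0 rR] := cutoff_radius_itv k.
  apply: (wintegral_kernel_eq0 mf df r0 rR (mF k) (bF k)).
    by move=> z /cutoff_support; rewrite /F => ->; rewrite mulr0.
  move=> j; rewrite -(@cutoff_orth k j.+1 0)//; apply: eq_wintegral => z _.
  by rewrite /F /bimonomial -(addn1 j) exprD !mulrA.
apply: (wintegral_limit0 _ (L2_majorant_integrable Rad fL2) _ _ F0).
- by move=> k; exact: wmeasurableM.
- move=> k p Dp; apply: le_L2_majorant => //.
  by apply: bF; exact/discP.
- move=> z zR; have cz := cutoff_cvg zR.
  have E k : f z * F k z = f z * z * (cutoff k z)%:C%C.
    by rewrite /F /bimonomial expr0 expr1 mulr1 mulrA.
  split; under eq_fun do rewrite E.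
    under eq_fun do rewrite (ReM (f z * z)) ReC ImC mulr0 subr0.
    by have := cvgM (cvg_cst (complex.Re (f z * z))) cz; rewrite mulr1 => h; exact: h.
  under eq_fun do rewrite (ImM (f z * z)) ReC ImC mulr0 add0r.
  by have := cvgM (cvg_cst (complex.Im (f z * z))) cz; rewrite mulr1 => h; exact: h.
Qed.

(** Up to a factor the kernel is conj(u_(m+1)). On the k-th disc it gets the moments [A k] and [B k]
    of that disc as coefficients: paired with z^j both terms vanish for j <> m, and for j = m they
    give A B - B A = 0. Then k tends to infinity. *)
Lemma bergman_kernel_orth f m : bergman Rad w f ->
  wintegral (fun z => f z * ((cn2 Rad w m)%:C%C * bimonomial 1 m.+1 z -
                             (cn2 Rad w m.+1)%:C%C * bimonomial 0 m z)) = 0.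
Proof.
move=> bf; have df := bergman_cderivable bf; have [_ fL2] := bf.
have mf := L2_wmeasurable fL2.
pose A k := (cutoff_moment k m)%:C%C; pose B k := (cutoff_moment k m.+1)%:C%C.
pose F k z := A k * (bimonomial 1 m.+1 z * (cutoff k z)%:C%C) -
  B k * (bimonomial 0 m z * (cutoff k z)%:C%C).
have mF k : wmeasurable (F k).
  have mc := wmeasurable_cutoff k.
  exact: (wmeasurableB
    (wmeasurableM (wmeasurable_cst (A k)) (wmeasurableM (wmeasurable_bimonomial 1 m.+1) mc))
    (wmeasurableM (wmeasurable_cst (B k)) (wmeasurableM (wmeasurable_bimonomial 0 m) mc))).
pose I := Rintegral mu D W.
(* [M] does not depend on [k], since truncated moments are at most a power of [Rad] times the total
   mass. *)
pose M := (Rad ^+ 2) ^+ m * I * Rad ^+ (1 + m.+1) + (Rad ^+ 2) ^+ m.+1 * I * Rad ^+ (0 + m).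
have bF k z : cabs z < Rad -> cabs (F k z) <= M.
  move=> zR; have /andP[c0 c1] := cutoff_itv k z.
  rewrite (le_trans (le_cabsB _ _))// !(cabsM (_%:C%C)) /A /B !cabsC.
  have bc i j : cabs (bimonomial i j z * (cutoff k z)%:C%C) <= Rad ^+ (i + j).
    rewrite cabsM cabsC ger0_norm// -[leRHS]mulr1.
    by rewrite ler_pM ?cabs_ge0// cabs_bimonomial_le.
  by rewrite lerD// ler_pM ?cabs_ge0 ?cutoff_moment_itv// bc.
have F0 k : wintegral (fun z => f z * F k z) = 0.
  have /andP[r0 rR] := cutoff_radius_itv k.
  apply: (wintegral_kernel_eq0 mf df r0 rR (mF k) (bF k)).
    by move=> z /cutoff_support; rewrite /F => ->; rewrite !mulr0 subrr.
  move=> j.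
  have iw := wintegrable_bimonomial_cutoff k.
  rewrite (eq_wintegral (G := fun z =>
     A k * (bimonomial j.+1 m.+1 z * (cutoff k z)%:C%C) -
     B k * (bimonomial j m z * (cutoff k z)%:C%C))); last first.
    by move=> z _; rewrite /F /bimonomial -(addn1 j) exprD; ring.
  rewrite wintegralB; [|exact: wintegrableZ|exact: wintegrableZ].
  rewrite (wintegralZ _ (iw _ _)) (wintegralZ _ (iw _ _)).
  have [->|jm] := eqVneq j m.
    by rewrite !wintegral_cutoff_diag -/(A k) -/(B k) (mulrC (A k)) subrr.
  by rewrite !cutoff_orth ?mulr0 ?subrr.
apply: (wintegral_limit0 _ (L2_majorant_integrable M fL2) _ _ F0).
- by move=> k; exact: wmeasurableM.
- move=> k p Dp; apply: le_L2_majorant => //.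
  by apply: bF; exact/discP.
- move=> z zR; have cz := cutoff_cvg zR.
  pose u := f z * bimonomial 1 m.+1 z; pose v := f z * bimonomial 0 m z.
  have E (a b c : R) : f z * (a%:C%C * (bimonomial 1 m.+1 z * c%:C%C) -
      b%:C%C * (bimonomial 0 m z * c%:C%C)) = (a * c)%:C%C * u - (b * c)%:C%C * v.
    by rewrite !rmorphM /u /v /=; ring.
  (* The factor 1 is the limit of the cutoff; writing it out gives the limit the shape of [E]. *)
  have E1 (a b : R) : f z * (a%:C%C * bimonomial 1 m.+1 z - b%:C%C * bimonomial 0 m z)
      = (a * 1)%:C%C * u - (b * 1)%:C%C * v.
    by rewrite !mulr1 /u /v; ring.
  have Re2 (a b : R) : complex.Re (a%:C%C * u - b%:C%C * v) =
      a * complex.Re u - b * complex.Re v.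
    by rewrite ReD ReN (ReM _ u) (ReM _ v) !ReC !ImC !mul0r !subr0.
  have Im2 (a b : R) : complex.Im (a%:C%C * u - b%:C%C * v) =
      a * complex.Im u - b * complex.Im v.
    by rewrite ImD ImN (ImM _ u) (ImM _ v) !ReC !ImC !mul0r !addr0.
  have ca : cutoff_moment k m * cutoff k z @[k --> \oo] --> cn2 Rad w m * 1.
    exact: (cvgM (@cutoff_moment_cvg m) cz).
  have cb : cutoff_moment k m.+1 * cutoff k z @[k --> \oo] --> cn2 Rad w m.+1 * 1.
    exact: (cvgM (@cutoff_moment_cvg m.+1) cz).
  rewrite E1 Re2 Im2; split; under eq_fun do rewrite /F /A /B E ?Re2 ?Im2.
    exact: (cvgB (cvgM ca (cvg_cst (complex.Re u))) (cvgM cb (cvg_cst (complex.Re v)))).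
  exact: (cvgB (cvgM ca (cvg_cst (complex.Im u))) (cvgM cb (cvg_cst (complex.Im v)))).
Qed.

End WeightedDisc.

(** * The canonical solutions *)

Section CanonicalSolution.
Variables (R : realType) (Rad : R) (w : R -> R).
Local Notation T := (measurableTypeR R * measurableTypeR R)%type.
Local Notation mu := (@leb2 R).
Local Notation D := (disc2 Rad : set T).
Local Notation W := (weight w).
Local Notation c := (cn2 Rad w).
Implicit Types (f g F G : R[i] -> R[i]) (z : R[i]) (p : T).

Hypothesis hRad : 0 < Rad.
Hypothesis hw_meas : measurable_fun `[0, Rad[ w.
Hypothesis hw_ge0 : forall r, 0 <= r -> r < Rad -> 0 <= w r.
Hypothesis hbasis : orthogonal_basis Rad w (@monomial R).

Let mD : measurable D := measurable_disc2 Rad.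
Let W_ge0 p : D p -> 0 <= W p := weight_ge0 hRad hw_ge0 (p := p).

Let bergman_monomial n : bergman Rad w (monomial n).
Proof. by case: hbasis. Qed.

Let horth i j : i != j -> cinner Rad w (@monomial R i) (@monomial R j) = 0.
Proof. by case: hbasis => _ [_ [h _]]; exact: h. Qed.

Lemma integrable_moment n : mu.-integrable D (EFin \o (fun p => cabs2 (toC p) ^+ n * W p)).
Proof.
have [_ /(L2_sq_integrable hRad hw_meas hw_ge0)] := bergman_monomial n.
by apply: eq_integrable => // p _ /=; rewrite /monomial cabs2X.
Qed.

(** The constant 1 is the monomial z^0 of A^2, so dmu has finite mass. *)
Let iW : mu.-integrable D (EFin \o W).
Proof.
by apply: eq_integrable (integrable_moment 0) => // p _ /=; rewrite expr0 mul1r.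
Qed.

Lemma cn2E n : c n = Rintegral mu D (fun p => cabs2 (toC p) ^+ n * W p).
Proof.
rewrite /cn2 /nrm2 /Rintegral; congr fine.
by apply: eq_integral => p _; rewrite /monomial cabs2X.
Qed.

Lemma nrm2_ge0 f : (0 <= nrm2 Rad w f)%E.
Proof.
by apply: integral_ge0 => p Dp; rewrite lee_fin mulr_ge0 ?cabs2_ge0// W_ge0.
Qed.

Lemma cn2_gt0 n : 0 < c n.
Proof.
have [_ [_ [_ nf]]] := bergman_monomial n.
have n0 : nrm2 Rad w (@monomial R n) != 0%E by case: hbasis => _ [].
by rewrite /cn2 fine_gt0// nf andbT lt_neqAle eq_sym n0 nrm2_ge0.
Qed.

Lemma cn2S_le n : c n.+1 <= Rad ^+ 2 * c n.
Proof.
rewrite !cn2E -(RintegralZl _ mD (integrable_moment n)).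
apply: le_Rintegral => //; first exact: integrable_moment.
  by apply: eq_integrable (integrableZl mD (Rad ^+ 2) (integrable_moment n)).
move=> p Dp; rewrite exprS mulrA ler_wpM2r ?W_ge0//.
rewrite ler_wpM2r ?exprn_ge0 ?cabs2_ge0// ltW//.
Qed.

Lemma L2_integrable f : wmeasurable Rad f ->
  mu.-integrable D (EFin \o (fun p => cabs2 (f (toC p)) * W p)) -> L2 Rad w f.
Proof. by move=> [mR mI] fi; split => //; split => //; exact: integrable_lty fi. Qed.

Lemma nrm2_Rintegral f : L2 Rad w f ->
  nrm2 Rad w f = (Rintegral mu D (fun p => cabs2 (f (toC p)) * W p))%:E.
Proof.
move=> [_ [_ nf]]; rewrite fineK// ge0_fin_numE//; exact: nrm2_ge0.
Qed.

Lemma L2_bounded F (M : R) : wmeasurable Rad F ->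
  (forall z, cabs z < Rad -> cabs (F z) <= M) -> L2 Rad w F.
Proof.
move=> mF FM; apply: L2_integrable => //.
have iM := integrable_weightZ iW (M ^+ 2).
apply: (le_integrable mD _ _ iM).
  apply/measurable_EFinP; apply: measurable_funM; first exact: cmeasurable_cabs2.
  exact: measurable_weight.
move=> p Dp; have pR := (discP hRad p).1 Dp; have W0 := W_ge0 Dp.
have FMp := FM _ pR; have M0 := le_trans (cabs_ge0 _) FMp.
rewrite /= lee_fin !normrM (ger0_norm W0) ler_wpM2r// (ger0_norm M0) -expr2.
by rewrite ger0_norm ?cabs2_ge0// -sqr_cabs; apply: lerXn2r; rewrite ?nnegrE ?cabs_ge0.
Qed.

Lemma bergmanZ (k : R[i]) f : bergman Rad w f -> bergman Rad w (fun z => k * f z).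
Proof.
move=> [hf fL2]; have mf := L2_wmeasurable fL2; split.
  move=> z /hf df; have h : cderivable (fun z => k * f z) z.
    exact: (@cderivableM R (fun=> k) f z (@cderivable_cst R k z) df).
  exact: h.
apply: L2_integrable; first exact: (wmeasurableM (wmeasurable_cst Rad k) mf).
have := integrableZl mD (cabs2 k) (L2_sq_integrable hRad hw_meas hw_ge0 fL2).
by apply: eq_integrable => // p _ /=; rewrite cabs2M -mulrA EFinM.
Qed.

Lemma wintegral_bimonomial_diag n : wintegral Rad w (bimonomial n n) = (c n)%:C%C.
Proof.
have E p : bimonomial n n (toC p) * (W p)%:C%C = (cabs2 (toC p) ^+ n * W p)%:C%C.
  by rewrite rmorphM rmorphXn /= -mulcJ /bimonomial exprMn.
rewrite cn2E; apply: complexP; rewrite /wintegral /cintegral.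
  by apply: eq_Rintegral => p _; rewrite E.
rewrite [LHS](_ : _ = Rintegral mu D (fun=> 0)).
  by rewrite /Rintegral integral0.
by apply: eq_Rintegral => p _; rewrite E.
Qed.

(** [c n] is the squared norm of z^n, written c_n^2 in the statement, so [scal n] is 1 / c_n. *)
Let scal n : R := (Num.sqrt (c n))^-1.

Let scal_gt0 n : 0 < scal n.
Proof. by rewrite invr_gt0 sqrtr_gt0 cn2_gt0. Qed.

Let scal_sqr n : scal n ^+ 2 = (c n)^-1.
Proof. by rewrite exprVn sqr_sqrtr// ltW// cn2_gt0. Qed.

Definition unit_monomial n z : R[i] := (scal n)%:C%C * monomial n z.

Lemma bergman_unit_monomial n : bergman Rad w (unit_monomial n).
Proof. exact: bergmanZ. Qed.

Let scalJ n z : ((unit_monomial n z)^*)%C = (scal n)%:C%C * (z^*)%C ^+ n.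
Proof. by rewrite conjcM /monomial conjcX conjc_real. Qed.

Lemma unit_monomial_orthonormal : orthonormal_basis Rad w unit_monomial.
Proof.
split; [exact: bergman_unit_monomial|split].
  move=> i j; rewrite cinnerE.
  rewrite (eq_wintegral w hRad
    (G := fun z => ((scal i)%:C * (scal j)%:C)%C * bimonomial i j z)); last first.
    by move=> z _; rewrite scalJ /unit_monomial /monomial /bimonomial; ring.
  rewrite (wintegralZ _ (wintegrable_bimonomial hRad hw_meas hw_ge0 iW _ _)).
  have [<-|ij] := eqVneq i j; last by rewrite (bimonomial_orth hRad horth)// mulr0.
  rewrite wintegral_bimonomial_diag -!rmorphM /= -expr2 scal_sqr mulVf ?gt_eqF ?cn2_gt0//.
move=> f bf f0; have [_ fL2] := bf.
case: hbasis => _ [_ [_]]; apply=> // n; have := f0 n; rewrite !cinnerE.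
have iz : wintegrable Rad w (fun z => f z * bimonomial 0 n z).
  apply: (wintegrable_L2 hRad hw_meas hw_ge0 iW fL2 (wmeasurable_bimonomial Rad 0 n)
    (cabs_bimonomial_le hRad 0 n)).
rewrite (eq_wintegral w hRad (G := fun z => (scal n)%:C%C * (f z * bimonomial 0 n z))); last first.
  by move=> z _; rewrite scalJ /bimonomial expr0; ring.
rewrite (wintegralZ _ iz) => /eqP; rewrite mulf_eq0 -cabs_eq0 cabsC normr_eq0.
rewrite gt_eqF//= => /eqP <-; apply: (eq_wintegral w hRad) => z _.
by rewrite /bimonomial expr0 mul1r /monomial conjcX.
Qed.

(** The coefficient of z^m in the projection of conj(z) e_(m+1): the inner product with z^m, which
    is [scal m.+1 * c m.+1], divided by the squared norm of z^m. *)
Let beta m : R := scal m.+1 * c m.+1 / c m.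

Definition solution n z : R[i] := (z^*)%C * unit_monomial n z -
  (if n is m.+1 then (beta m)%:C%C * monomial m z else 0).

(** The conjugate of [solution n] up to the real factor [kscal n], cleared of the denominator [c m]
    to match the two orthogonality lemmas. *)
Definition kernel n z : R[i] :=
  if n is m.+1 then (c m)%:C%C * bimonomial 1 m.+1 z - (c m.+1)%:C%C * bimonomial 0 m z
  else z.

Let kscal n : R := if n is m.+1 then scal m.+1 / c m else scal 0.

Lemma solutionJ n z : ((solution n z)^*)%C = (kscal n)%:C%C * kernel n z.
Proof.
case: n => [|m]; rewrite /solution conjcB conjcM conjcK scalJ /kernel /kscal.
  by rewrite conjc0 expr0 subr0 mulr1 mulrC.
rewrite conjcM /monomial conjcX conjc_real /beta /bimonomial expr0 expr1 mul1r.
move: (scal m.+1) => s.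
have cm : (c m)%:C%C != 0 :> R[i].
  by rewrite -cabs_eq0 cabsC normr_eq0 gt_eqF// cn2_gt0.
by rewrite !real_complexM !real_complexV; field; exact: cm.
Qed.

Lemma wmeasurable_solution n : wmeasurable Rad (solution n).
Proof.
have mz n' : wmeasurable Rad (@monomial R n') by exact: (wmeasurableX n' (wmeasurable_id Rad)).
apply: wmeasurableB.
  exact: (wmeasurableM (wmeasurableJ (wmeasurable_id Rad))
    (wmeasurableM (wmeasurable_cst Rad (scal n)%:C%C) (mz n))).
case: n => [|m]; first exact: wmeasurable_cst.
exact: (wmeasurableM (wmeasurable_cst Rad (beta m)%:C%C) (mz m)).
Qed.

Lemma wmeasurable_kernel n : wmeasurable Rad (kernel n).
Proof.
case: n => [|m]; first exact: wmeasurable_id.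
exact: (wmeasurableB
  (wmeasurableM (wmeasurable_cst Rad (c m)%:C%C) (wmeasurable_bimonomial Rad 1 m.+1))
  (wmeasurableM (wmeasurable_cst Rad (c m.+1)%:C%C) (wmeasurable_bimonomial Rad 0 m))).
Qed.

Lemma kernel_bounded n : exists M, forall z, cabs z < Rad -> cabs (kernel n z) <= M.
Proof.
case: n => [|m]; first by exists Rad => z /ltW.
exists (c m * Rad ^+ (1 + m.+1) + c m.+1 * Rad ^+ (0 + m)) => z zR.
have c0 j : 0 <= c j by exact: ltW (cn2_gt0 j).
rewrite (le_trans (le_cabsB _ _))// (cabsM (c m)%:C%C) (cabsM (c m.+1)%:C%C).
rewrite !cabsC !(ger0_norm (c0 _)).
by apply: lerD; apply: ler_wpM2l => //; exact: (cabs_bimonomial_le hRad).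
Qed.

Lemma solution_L2 n : L2 Rad w (solution n).
Proof.
have [M hM] := kernel_bounded n.
apply: (@L2_bounded _ (`|kscal n| * M)); first exact: wmeasurable_solution.
by move=> z zR; rewrite -cabsJ solutionJ cabsM cabsC ler_wpM2l// hM.
Qed.

Lemma solution_canonical n : canonical_solution Rad w (unit_monomial n) (solution n).
Proof.
split; [exact: solution_L2|split].
  exists (fun z => if n is m.+1 then (beta m)%:C%C * monomial m z else 0); split=> //.
  case: n => [|m]; last exact: bergmanZ.
  (* For n = 0 the holomorphic part is the zero function, placed in A^2 as 0 times z^0. *)
  have := bergmanZ 0 (bergman_monomial 0); congr bergman.
  by apply/funext => z; rewrite mul0r.
move=> f bf; have [_ fL2] := bf; have [M hM] := kernel_bounded n.
have ik : wintegrable Rad w (fun z => f z * kernel n z).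
  exact: (wintegrable_L2 hRad hw_meas hw_ge0 iW fL2 (wmeasurable_kernel n) hM).
have k0 : wintegral Rad w (fun z => f z * kernel n z) = 0.
  case: (n) => [|m].
    exact: (bergman_zmul_orth hRad hw_meas hw_ge0 iW horth bf).
  exact: (bergman_kernel_orth hRad hw_meas hw_ge0 iW horth m bf).
(* u conj(f) is the conjugate of [kscal n] times f times the kernel, so the inner product reduces to
   [k0]. *)
rewrite cinnerE (eq_wintegral w hRad
  (G := fun z => ((kscal n)%:C%C * (f z * kernel n z))^*%C)); last first.
  by move=> z _; rewrite mulrCA -solutionJ conjcM conjcK mulrC.
rewrite (wintegralJ (wintegrableZ _ ik)) (wintegralZ _ ik) k0 mulr0.
exact: conjc0.
Qed.

(** * Norms of the canonical solutions and the ratio sequence *)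

Let a n : R := c n.+1 / c n.
(** The ratios shifted by one, with value 0 in front, so that n = 0 also fits the difference
    formula: the squared norm of u_0 is a 0 itself. *)
Let b n : R := if n is m.+1 then a m else 0.

(** With s = [scal m.+1], integrating (s |z|^2 - beta)^2 |z|^(2m) gives s^2 c_(m+2) - 2 s beta
    c_(m+1) + beta^2 c_m in terms of [c]. Since s^2 c_(m+1) = 1, the last two terms combine to -
    c_(m+1) / c_m. *)
Lemma solution_nrm2 n : nrm2 Rad w (solution n) = (b n.+1 - b n)%:E.
Proof.
rewrite (nrm2_Rintegral (solution_L2 n)); congr EFin.
have im k j : mu.-integrable D (EFin \o (fun p => k * (cabs2 (toC p) ^+ j * W p))).
  by apply: eq_integrable (integrableZl mD k (integrable_moment j)).
have Im k j : Rintegral mu D (fun p => k * (cabs2 (toC p) ^+ j * W p)) = k * c j.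
  by rewrite (RintegralZl _ mD (integrable_moment j)) -cn2E.
case: n => [|m]; rewrite /b /a.
  rewrite subr0 mulrC -scal_sqr -Im; apply: eq_Rintegral => p _.
  rewrite /solution subr0 !cabs2M -[cabs2 (_^*)%C]sqr_cabs cabsJ sqr_cabs.
  by rewrite -[cabs2 _%:C%C]sqr_cabs cabsC real_normK ?num_real// /monomial cabs2X; ring.
pose k1 := scal m.+1 ^+ 2; pose k2 := - 2 * scal m.+1 * beta m; pose k3 := beta m ^+ 2.
rewrite [LHS](_ : _ = Rintegral mu D (fun p => k1 * (cabs2 (toC p) ^+ m.+2 * W p) +
  (k2 * (cabs2 (toC p) ^+ m.+1 * W p) + k3 * (cabs2 (toC p) ^+ m * W p)))); last first.
  apply: eq_Rintegral => p _; set z := toC p.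
  (* Pairing conj(z) with one factor z turns u_(m+1) into a real radial factor times z^m. *)
  have -> : solution m.+1 z = (scal m.+1 * cabs2 z - beta m)%:C%C * z ^+ m.
    rewrite real_complexB real_complexM -mulcJ /solution /unit_monomial /monomial exprS.
    by ring.
  rewrite cabs2M cabs2X -sqr_cabs cabsC real_normK ?num_real// /k1 /k2 /k3 !exprS.
  by ring.
have im23 : mu.-integrable D (EFin \o (fun p => k2 * (cabs2 (toC p) ^+ m.+1 * W p) +
    k3 * (cabs2 (toC p) ^+ m * W p))).
  exact: eq_integrable (integrableD mD (im k2 m.+1) (im k3 m)).
rewrite (RintegralD mD (im k1 m.+2) im23) (RintegralD mD (im k2 m.+1) (im k3 m)) !Im.
rewrite /k1 /k2 /k3 /beta.
have c0 := cn2_gt0 m; have c1 := cn2_gt0 m.+1.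
transitivity (scal m.+1 ^+ 2 * (c m.+2 - 2 * c m.+1 / c m * c m.+1 +
  (c m.+1 / c m) ^+ 2 * c m)); first by ring.
by rewrite scal_sqr; field; rewrite !gt_eqF.
Qed.

Lemma ratio_le n : a n <= Rad ^+ 2.
Proof. by rewrite ler_pdivrMr ?cn2_gt0// cn2S_le. Qed.

(** This is the log-convexity of the moments, read off from a squared norm being nonnegative. *)
Lemma ratio_nondecreasing : {homo a : n m / (n <= m)%N >-> n <= m}.
Proof.
apply/nondecreasing_seqP => n.
by have := nrm2_ge0 (solution n.+1); rewrite solution_nrm2 lee_fin subr_ge0.
Qed.

Lemma ratio_cvg : exists l : R, (fun n => c n.+1 / c n) @ \oo --> l.
Proof.
apply/cvg_ex; apply: nondecreasing_is_cvgn; first exact: ratio_nondecreasing.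
by exists (Rad ^+ 2) => _ [n _ <-]; exact: ratio_le.
Qed.

Lemma hilbert_schmidt : S_hilbert_schmidt Rad w.
Proof.
exists unit_monomial; split; first exact: unit_monomial_orthonormal.
exists solution; split; first exact: solution_canonical.
apply: (@le_lt_trans _ _ (Rad ^+ 2)%:E); last exact: ltry.
apply: lime_le; first by apply: is_cvg_nneseries => n _ _; exact: nrm2_ge0.
apply: nearW => N; rewrite (eq_bigr (fun n => (b n.+1 - b n)%:E)); last first.
  by move=> n _; exact: solution_nrm2.
(* The partial sum is [b N]: 0 for N = 0, and otherwise a ratio, bounded by [Rad ^+ 2]. *)
rewrite sumEFin lee_fin telescope_sumr// subr0.
by case: N => [|N]; [exact: sqr_ge0|exact: ratio_le].
Qed.

End CanonicalSolution.

Theorem theorem2p1 (R : realType) (Rad : R) (w : R -> R)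
  (hRad : 0 < Rad)
  (hw_meas : measurable_fun `[0, Rad[ w)
  (hw_ge0 : forall r, 0 <= r -> r < Rad -> 0 <= w r)
  (hbasis : orthogonal_basis Rad w (@monomial R)) :
  S_hilbert_schmidt Rad w <->
  exists l : R, (fun n => cn2 Rad w n.+1 / cn2 Rad w n) @ \oo --> l.
Proof.
by split=> _; [exact: (ratio_cvg hRad hw_meas hw_ge0 hbasis)
  |exact: (hilbert_schmidt hRad hw_meas hw_ge0 hbasis)].
Qed.
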